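(* Let $p\ge 2$, $\alpha=p-1$, $0<R<\infty$ and $\theta\ge\alpha$. Then for every $\nu$ with $0\le\nu<\lambda_{\alpha,\theta}$, $$S(p,\nu,\theta,R)=\sup_{u\in X^{1,p}_R(\alpha,\theta),\ H_\nu(u)\le 1}\int_0^R e^{\mu_{\alpha,\theta}|u|^{\frac{p}{p-1}}}\,\mathrm d\lambda_\theta<\infty .$$
   Context: For $s\ge 0$ let $\omega_s=\frac{2\pi^{s/2}}{\Gamma(s/2)}$ and let $\mathrm d\lambda_s=\omega_s r^s\,\mathrm dr$ on $(0,R)$; $L^q_s=L^q((0,R),\mathrm d\lambda_s)$. The space $X^{1,p}_R(\alpha,\theta)$ is the completion of the set of all $u\in AC_{loc}(0,R)$ with $\lim_{r\to R}u(r)=0$, $u\in L^p_\theta$, $u'\in L^p_\alpha$, with respect to the norm $\|u\|=(\|u\|^p_{L^p_\theta}+\|u'\|^p_{L^p_\alpha})^{1/p}$. Set $\mu_{\alpha,\theta}=(\theta+1)\omega_\alpha^{1/\alpha}$, $\lambda_{\alpha,\theta}=\inf_{u\in X^{1,p}_R(\alpha,\theta)\setminus\{0\}}\|u'\|^p_{L^p_\alpha}/\|u\|^p_{L^p_\theta}$, and $H_\nu(u)=(\|u'\|^p_{L^p_\alpha}-\nu\|u\|^p_{L^p_\theta})^{1/p}$. *)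

(* Defs.v *)
From HB Require Import structures.
From mathcomp Require Import all_boot all_order all_algebra.
From mathcomp Require Import all_classical all_reals all_analysis.
Set Implicit Arguments. Unset Strict Implicit. Unset Printing Implicit Defensive.
Import Order.TTheory GRing.Theory Num.Theory.
Import numFieldNormedType.Exports.
Local Open Scope classical_set_scope.
Local Open Scope ring_scope.

Section Defs.
Variable R : realType.

(* Euler Gamma function (used only at positive arguments). *)
Definition Gamma (x : R) : R :=
  fine (\int[lebesgue_measure]_(t in `](0%R : R), +oo[) (t `^ (x - 1) * expR (- t))%:E)%E.

Definition omega (s : R) : R := 2 * pi `^ (s / 2) / Gamma (s / 2).

Definition wint (s Rad : R) (f : R -> R) : \bar R :=
  (\int[lebesgue_measure]_(r in `]0%R, Rad%R[) (f r * (omega s * r `^ s))%:E)%E.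

Definition Lpnp (p s Rad : R) (f : R -> R) : \bar R :=
  wint s Rad (fun r => `|f r| `^ p).

Definition inLp (p s Rad : R) (f : R -> R) : Prop :=
  measurable_fun `]0%R, Rad%R[ f /\ (Lpnp p s Rad f < +oo)%E.

Definition abs_cont_on (a b : R) (f : R -> R) : Prop :=
  forall eps : R, 0 < eps -> exists2 delta : R, 0 < delta &
    forall (n : nat) (x y : nat -> R),
      (forall i, (i < n)%N -> a <= x i /\ x i <= y i /\ y i <= b) ->
      (forall i, (i.+1 < n)%N -> y i <= x i.+1) ->
      \sum_(i < n) (y i - x i) < delta ->
      \sum_(i < n) `|f (y i) - f (x i)| < eps.

Definition AC_loc (Rad : R) (u : R -> R) : Prop :=
  forall a b, 0 < a -> a < b -> b < Rad -> abs_cont_on a b u.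

Definition Xdense (p alpha theta Rad : R) (u : R -> R) : Prop :=
  AC_loc Rad u /\ (u x @[x --> Rad^'-] --> 0) /\
  inLp p theta Rad u /\ inLp p alpha Rad (derive1 u).

(* The completion X^{1,p}_Rad(alpha,theta), realized concretely as the closure
   of {(u,u') : u in Xdense} in L^p_theta x L^p_alpha: an element is a pair
   (u, g) where g plays the role of u'. *)
Definition Xspace (p alpha theta Rad : R) (u g : R -> R) : Prop :=
  measurable_fun `]0%R, Rad%R[ u /\ measurable_fun `]0%R, Rad%R[ g /\
  exists v : nat -> R -> R, (forall n, Xdense p alpha theta Rad (v n)) /\
    (Lpnp p theta Rad (fun r => v n r - u r) @[n --> \oo] --> 0%E) /\
    (Lpnp p alpha Rad (fun r => derive1 (v n) r - g r) @[n --> \oo] --> 0%E).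

Definition mu (alpha theta : R) : R := (theta + 1) * omega alpha `^ (1 / alpha).

Definition lambda_at (p alpha theta Rad : R) : \bar R :=
  ereal_inf [set x : \bar R | exists u g : R -> R,
     Xspace p alpha theta Rad u g /\ Lpnp p theta Rad u != 0%E /\
     x = (fine (Lpnp p alpha Rad g) / fine (Lpnp p theta Rad u))%:E].

Definition H_nu (p alpha theta Rad nu : R) (u g : R -> R) : R :=
  (fine (Lpnp p alpha Rad g) - nu * fine (Lpnp p theta Rad u)) `^ (1 / p).

Definition S_sup (p nu theta Rad : R) : \bar R :=
  ereal_sup [set wint theta Rad (fun r => expR (mu (p - 1) theta * `|u r| `^ (p / (p - 1))))
            | u in [set u : R -> R | exists g : R -> R,
                     Xspace p (p - 1) theta Rad u g /\ H_nu p (p - 1) theta Rad nu u g <= 1]].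

End Defs.

(* Main.v *)
(** Moser's argument. For [nu = 0] and [t = (theta + 1) ln (Rad / r)], Hoelder's
    inequality bounds [mu |u|^q], [q = p / (p - 1)], by [t] when the energy is at
    most 1. Near-equality within [N] can only occur for [t <= K N] or on one
    window of [t] of length [2 K N], since reaching it at two distant points
    would cost too much energy; summing [exp (- N)] over [N] bounds the integral.

    For [nu < lambda] the term [nu |u|_p^p] is first absorbed: with
    [rho r = (1 + b r)^(1 - p)] and [b] large,
    [nu |v|_p^p <= \int (1 - rho) |v'|^p], by the definition of [lambda] applied
    to a truncation of [v] near the origin, where a Hardy inequality controls
    the rest. So [H_nu v <= 1] gives [\int rho |v'|^p <= 1], and the weight [rho]
    merely replaces [t] by [tau r = t + (theta + 1) b (Rad - r)], a bounded
    perturbation.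

    An element of the completion is the limit of functions whose [H_nu] is at
    most [1 + o(1)]; an a.e. convergent subsequence and Fatou's lemma conclude. *)

Require Import Defs.
From HB Require Import structures.
From mathcomp Require Import all_boot all_order all_algebra.
From mathcomp Require Import all_classical all_reals all_analysis.
From mathcomp Require Import measurable_realfun.
From mathcomp Require Import ring lra.
Import Order.TTheory GRing.Theory Num.Theory.
Import numFieldNormedType.Exports.
Local Open Scope classical_set_scope.
Local Open Scope ring_scope.

(** * Absolutely continuous functions are bounded by the integral of their derivative *)

(** If [rho] stayed below 1 at the origin, [tau] would grow faster than (theta + 1) ln (Rad / r),
    and exp(tau) r^theta would no longer be comparable to 1 / r: the constant mu is critical. So the
    share 1 - rho spent on the zeroth-order term has to vanish at 0, and linear vanishing keeps
    [tau] within a bounded distance of the logarithm. But lambda compares unweighted quantities and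
    says nothing about an energy weighted by 1 - rho. Truncation is the way around: the function
    frozen on (0, a) has no energy there, and the oscillation left over obeys a Hardy inequality
    whose weight has one power of r more than the energy, just what 1 - rho can pay for.

    Absolute continuity enters through |f b - f a| <= \int |f'| with f' the pointwise [derive1].
    Starting from the epsilon-delta definition, this rests on Jordan decomposition, Radon-Nikodym
    and Lebesgue differentiation.

    Approximants satisfy the constraint only in the limit, so the estimate is proved for any energy
    bound k, uniformly, with the exponent scaled by k^(-1/(p-1)). *)

Section AbsCont.
Variable R : realType.
Implicit Types (a b : R) (f : R -> R) (s : seq (R * R)).

(* A pair [q] stands for the interval [[q.2, q.1]], the convention of [variation_zip]. *)
Definition subitv a b (q : R * R) := [&& a <= q.2, q.2 < q.1 & q.1 <= b].
Definition itv_apart (q r : R * R) := (q.1 <= r.2) || (r.1 <= q.2).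
Definition disj_itvs a b s := all (subitv a b) s && pairwise itv_apart s.

(** [abs_cont_on] only speaks of families listed from left to right, whereas the components of an
    open set come in no particular order. Insertion sort: [q] goes between the intervals on its left
    and the others. *)
Lemma disj_itvs_sort a b s : disj_itvs a b s ->
  exists2 t, perm_eq t s & pairwise (fun q r : R * R => q.1 <= r.2) t.
Proof.
rewrite /disj_itvs; elim: s => [|q s ih] /=; first by exists [::].
move=> /andP[/andP[qab sab] /andP[qs ss]].
have [|t ts pt] := ih; first by rewrite sab.
set P := fun r : R * R => r.1 <= q.2.
exists ([seq r <- t | P r] ++ q :: [seq r <- t | predC P r]).
  rewrite perm_catC /= perm_cons perm_catC (perm_trans _ ts)//.
  exact/permPl/perm_filterC.
have tq r : r \in t -> subitv a b r /\ itv_apart q r.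
  by rewrite (perm_mem ts) => rs; rewrite (allP sab)// (allP qs).
rewrite pairwise_cat /= !pairwise_filter//= andbT; apply/andP; split.
  apply/allrelP => x y; rewrite mem_filter inE => /andP[Px xt].
  move=> /orP[/eqP->//|]; rewrite mem_filter /P /= => /andP[Py yt].
  have [/and3P[_ ? _]] := tq _ yt; rewrite /itv_apart (negbTE Py) orbF => ?.
  have /and3P[_ ? _] := qab.
  by apply: (le_trans Px); apply: le_trans (ltW _) _; last eassumption.
apply/allP => y; rewrite mem_filter /P /= => /andP[Py yt].
by have [_] := tq _ yt; rewrite /itv_apart (negbTE Py) orbF.
Qed.

Lemma abs_cont_disj_itvs a b f : abs_cont_on a b f ->
  forall e : R, 0 < e -> exists2 d : R, 0 < d & forall s, disj_itvs a b s ->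
    \sum_(q <- s) (q.1 - q.2) < d -> \sum_(q <- s) `|f q.1 - f q.2| < e.
Proof.
move=> acf e e0; have [d d0 H] := acf _ e0; exists d => // s sab sd.
have [t ts pt] := disj_itvs_sort _ _ _ sab.
rewrite -(perm_big _ ts) /= (big_nth (0, 0)) big_mkord.
have tab i : (i < size t)%N -> subitv a b (nth (0, 0) t i).
  move=> it; have /andP[/allP + _] := sab; apply.
  by rewrite -(perm_mem ts) mem_nth.
apply: (H _ (fun i => (nth (0, 0) t i).2) (fun i => (nth (0, 0) t i).1)).
- by move=> i /tab/and3P[? /ltW ? ?].
- move=> i it; have /(pairwiseP (0, 0)) := pt; apply => //.
  by rewrite inE ltnW.
- by move: sd; rewrite -(perm_big _ ts) /= (big_nth (0, 0)) big_mkord.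
Qed.

Lemma itv_partition_subitv x y (l : seq R) : itv_partition x y l ->
  disj_itvs x y (zip l (x :: l)) /\
  \sum_(q <- zip l (x :: l)) (q.1 - q.2) = y - x.
Proof.
elim: l x => [|h l ih] x /=.
  by move=> /itv_partition_nil ->; rewrite big_nil subrr.
move=> hl; have [xh hy] : x < h /\ h <= y.
  have /itv_partition_cons/itv_partition_le := hl; split => //.
  by case: hl => /= /andP[].
have [/andP[A B] C] := ih _ (itv_partition_cons hl).
rewrite big_cons C /=; split; last by ring.
rewrite /disj_itvs /= B andbT; apply/andP; split.
  rewrite /subitv /= lexx xh hy /=; apply: sub_all A => q /and3P[? ? ?].
  by apply/and3P; split => //; apply: le_trans (ltW xh) _.
by apply: sub_all A => q /and3P[? ? ?]; rewrite /itv_apart /=; apply/orP; left.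
Qed.

Notation TV := total_variation.

Lemma disj_itvs_replace a b s1 q s2 t : disj_itvs a b (s1 ++ q :: s2) ->
  disj_itvs q.2 q.1 t -> disj_itvs a b ((s1 ++ t) ++ s2).
Proof.
rewrite /disj_itvs -catA !all_cat !pairwise_cat/= => /andP[/andP[-> /andP[qab ->]]].
move=> /and3P[+ -> /andP[qs2 ->]] /andP[tq ->].
rewrite !allrel_catr !allrel_consr !andbT => /andP[s1q ->]; rewrite andbT.
move: qab => /and3P[? _ ?].
rewrite -!andbA /=; apply/and3P; split.
- apply/allP => r /(allP tq)/and3P[? ? ?]; apply/and3P; split => //.
    by apply: le_trans; eassumption.
  by apply: le_trans; eassumption.
- apply/allrelP => x y /(allP s1q)/orP[] h /(allP tq)/and3P[? ? ?].
    by apply/orP; left; exact: le_trans h _.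
  by apply/orP; right; apply: le_trans h.
- apply/allrelP => x y /(allP tq)/and3P[? ? ?] /(allP qs2)/orP[] h.
    by apply/orP; left; apply: le_trans h.
  by apply/orP; right; exact: le_trans h _.
Qed.

(** Subdividing the intervals of a family does not change its total length, so increments can be
    replaced by total variations with the same [d]; only the strictness of the bound is lost. *)
Lemma abs_cont_TV a b f : abs_cont_on a b f ->
  forall e : R, 0 < e -> exists2 d : R, 0 < d & forall s, disj_itvs a b s ->
    \sum_(q <- s) (q.1 - q.2) < d -> (\sum_(q <- s) TV q.2 q.1 f <= e%:E)%E.
Proof.
move=> /abs_cont_disj_itvs acf e e0; have [d d0 H] := acf _ e0.
exists d => // s.
(* Intervals in [s1] count by increments, those in [s2] by variations. A partition of the head of
   [s2] moves it to [s1], so that suprema are taken one interval at a time. *)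
suff K s2 s1 : disj_itvs a b (s1 ++ s2) -> \sum_(q <- s1 ++ s2) (q.1 - q.2) < d ->
  ((\sum_(q <- s1) `|f q.1 - f q.2|)%:E + \sum_(q <- s2) TV q.2 q.1 f <= e%:E)%E.
  by move=> ss sd; have := K s [::] ss sd; rewrite big_nil add0e.
elim: s2 s1 => [|q s2 ih] s1.
  by rewrite cats0 big_nil adde0 lee_fin => /H/[apply]/ltW.
move=> ss sd; rewrite big_cons.
have qq : q.2 < q.1.
  by have := ss; rewrite /disj_itvs all_cat /= => /andP[/and3P[_ /and3P[]]].
have rest0 : (0 <= \sum_(q0 <- s2) TV q0.2 q0.1 f)%E.
  have : all (subitv a b) s2.
    by have := ss; rewrite /disj_itvs all_cat /= => /andP[/and3P[]].
  elim: (s2) => [|r s3 ih3]; first by rewrite big_nil.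
  rewrite big_cons /= => /andP[/and3P[_ /ltW ? _] /ih3 ?].
  by rewrite adde_ge0// total_variation_ge0.
have part (l : seq R) : itv_partition q.2 q.1 l ->
  ((\sum_(q <- s1) `|f q.1 - f q.2|)%:E + ((variation q.2 q.1 f l)%:E +
   \sum_(q <- s2) TV q.2 q.1 f) <= e%:E)%E.
  move=> ql; have [tq tl] := itv_partition_subitv _ _ _ ql.
  have := ih (s1 ++ zip l (q.2 :: l)).
  rewrite [\sum_(q0 <- s1 ++ _) `|_|]big_cat /= -(variation_zip f ql) EFinD -addeA; apply.
    exact: disj_itvs_replace ss tq.
  by move: sd; rewrite !big_cat /= tl big_cons addrA.
(* The trivial partition of [q] already shows that the remaining variations are finite; they can
   then be subtracted before taking the supremum. *)
have restf : (\sum_(q0 <- s2) TV q0.2 q0.1 f)%E \is a fin_num.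
  rewrite ge0_fin_numE//; have := part _ (itv_partition1 qq).
  move=> /le_lt_trans - /(_ _ (ltry _)); apply: le_lt_trans.
  rewrite addeA leeDr// -EFinD lee_fin addr_ge0 ?variation_ge0//.
  by apply: sumr_ge0.
rewrite addeCA -leeBrDr; last by rewrite fin_numD restf.
apply: ge_ereal_sup => _ [_ [l ql <-] <-].
rewrite leeBrDr; last by rewrite fin_numD restf.
by rewrite addeCA; exact: part.
Qed.

Lemma abs_cont_bounded_variation a b f : a <= b -> abs_cont_on a b f ->
  bounded_variation a b f.
Proof.
move=> ab acf; apply/bounded_variationP => //.
have [d d0 H] := abs_cont_TV _ _ _ acf _ (ltr01).
rewrite ge0_fin_numE ?total_variation_ge0//.
(* Induction by steps of length d / 2, half of [d] because [H] asks for a length strictly below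
   [d]. *)
have K n x : a <= x -> x <= b -> x - a < d / 2 * n%:R -> (TV a x f < +oo)%E.
  elim: n x => [|n ih] x ax xb; first by rewrite mulr0 subr_lt0 ltNge ax.
  move=> xad; have [xd|xd] := ltP (x - a) (d * 2^-1).
    have [->|xa] := eqVneq x a; first by rewrite total_variationxx ltry.
    have := H [:: (x, a)]; rewrite !big_seq1 /= => K.
    apply: le_lt_trans (K _ _) (ltry _); last by lra.
    by rewrite /disj_itvs /= /subitv /= lexx lt_neqAle eq_sym xa ax xb.
  rewrite (total_variationD (c := x - d * 2^-1)); [|lra|lra].
  rewrite lte_add_pinfty// ?ih//; [lra|lra| |].
    move: xad; rewrite -natr1; lra.
  have := H [:: (x, x - d * 2^-1)]; rewrite !big_seq1 /= => K.
  apply: le_lt_trans (K _ _) (ltry _); last by lra.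
  by rewrite /disj_itvs /= /subitv /= xb !andbT; apply/andP; split; lra.
apply: (K (Num.bound ((b - a) / (d / 2)))) => //.
rewrite mulrC -ltr_pdivrMr ?divr_gt0//; apply: archi_boundP.
by rewrite divr_ge0 ?subr_ge0// divr_ge0// ltW.
Qed.

(** Composition with [clamp a b] extends a function on [a, b] to the whole line by constants, as the
    cumulative function of a Stieltjes measure must be defined everywhere. *)
Definition clamp a b (x : R) := Num.max a (Num.min b x).

Lemma clamp_in a b x : a <= b -> a <= clamp a b x <= b.
Proof.
by move=> ab; rewrite /clamp le_max lexx ge_max ab ge_min lexx.
Qed.

Lemma clamp_id a b x : a <= x <= b -> clamp a b x = x.
Proof. by move=> /andP[ax xb]; rewrite /clamp min_r// max_r. Qed.

Lemma le_clamp a b x y : x <= y -> clamp a b x <= clamp a b y.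
Proof.
move=> xy; rewrite /clamp /Order.max /Order.min.
by repeat case: ifPn; rewrite -?leNgt => *; lra.
Qed.

Lemma clamp_lipschitz a b x y : a <= b -> x <= y ->
  clamp a b y - clamp a b x <= y - x.
Proof.
move=> ab xy; rewrite /clamp.
by case: (leP b y) => ?; case: (leP b x) => ?; rewrite /Order.max;
  repeat case: ifPn; rewrite -?leNgt => *; lra.
Qed.

(** * Density of a nondecreasing absolutely continuous function *)

Section density.
Variables (a b : R) (H : R -> R).
Hypothesis ab : a < b.
Hypothesis ndH : {in `[a, b] &, nondecreasing_fun H}.
Hypothesis acH : forall e : R, 0 < e -> exists2 d : R, 0 < d &
  forall s, disj_itvs a b s -> \sum_(q <- s) (q.1 - q.2) < d ->
    \sum_(q <- s) (H q.1 - H q.2) <= e.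

Let G := H \o clamp a b.

Let clab x : clamp a b x \in `[a, b].
Proof. by rewrite in_itv /= clamp_in// ltW. Qed.

Let ndG : nondecreasing G.
Proof. by move=> x y xy; apply: ndH => //; exact: le_clamp. Qed.

Let rcG x : G @ x^'+ --> G x.
Proof.
apply/cvgrPdist_lt => e e0; have [|d d0 Hd] := acH (e / 2).
  by rewrite divr_gt0.
near=> y; have xy : x < y by near: y; exact: nbhs_right_gt.
rewrite distrC ger0_norm ?subr_ge0 ?ndG ?ltW//.
have [eqc|neq] := eqVneq (clamp a b x) (clamp a b y).
  by rewrite /G /= eqc subrr.
apply: (@le_lt_trans _ _ (e / 2)); last by rewrite ltr_pdivrMr// ltr_pMr// ltr1n.
have := Hd [:: (clamp a b y, clamp a b x)]; rewrite !big_seq1 /=; apply.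
  have [/andP[h1 _] /andP[_ h2]] := (clamp_in _ _ x (ltW ab), clamp_in _ _ y (ltW ab)).
  rewrite /disj_itvs /= !andbT; apply/and3P; split => //=.
  by rewrite lt_neqAle neq le_clamp// ltW.
apply: le_lt_trans (clamp_lipschitz _ _ _ _ _ _) _; [exact: ltW|exact: ltW|].
rewrite ltrBlDl; near: y; apply: nbhs_right_lt; by rewrite ltrDl.
Unshelve. all: by end_near. Qed.

Let cG : cumulative R R := HB.pack G (isCumulative.Build R _ R G ndG rcG).
Let lsm : {measure set (measurableTypeR R) -> \bar R} :=
  lebesgue_stieltjes_measure cG.

Let lsm_itv x y : a <= x -> x <= y -> y <= b -> lsm `]x, y]%classic = (H y - H x)%:E.
Proof.
move=> ax xy yb; transitivity (wlength cG `]x, y]%classic).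
  exact: (measurable_mu_extE _ (is_ocitv x y)).
have GE z : a <= z -> z <= b -> cG z = H z.
  by move=> az zb; rewrite /= /G /= clamp_id// az zb.
by rewrite wlength_itv_bnd// !GE// ?(le_trans xy)// (le_trans ax).
Qed.

Let lsm_fin : (lsm `]a, b]%classic < +oo)%E.
Proof. by rewrite lsm_itv ?lexx// ?ltry// ltW. Qed.

Let mab : measurable (`]a, b]%classic : set (measurableTypeR R)).
Proof. exact: measurable_itv. Qed.

(** The window is a bounded open neighbourhood of [a, b]: boundedness is what makes [inf] and [sup]
    the end points of a component. *)
Let open_itvE (I : set R) : open I -> is_interval I -> I `<=` `]a - 1, b + 1[ ->
  I = [set r | inf I < r < sup I].
Proof.
move=> oI iI Iab; rewrite -interval_bounded_interior//.
- by apply/esym/interior_id.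
- by exists (a - 1) => x /Iab; rewrite /= in_itv /= => /andP[/ltW].
- by exists (b + 1) => x /Iab; rewrite /= in_itv /= => /andP[_ /ltW].
Qed.

(** Finitely many intervals are tested at a time, so [acH] applies to their traces on [a, b], with
    end points [i q] and [s q]; empty traces are filtered out because [subitv] is strict. *)
Let cover_bound (e : R) : 0 < e -> exists2 d : R, 0 < d & forall I : nat -> set R,
  (forall q : nat, open (I q) /\ is_interval (I q) /\ I q `<=` `]a - 1, b + 1[) ->
  trivIset setT I -> (lebesgue_measure (\bigcup_q I q) < d%:E)%E ->
  (forall n, \sum_(q < n) lsm (I q `&` `]a, b]) <= e%:E)%E.
Proof.
move=> e0; have [d d0 Hd] := acH _ e0; exists d => // I PI tI Id n.
pose i q := Num.max a (inf (I q)); pose s q := Num.min b (sup (I q)).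
have IE q : I q = [set r | inf (I q) < r < sup (I q)].
  by have [oI [iI Iab]] := PI q; exact: open_itvE.
have IE' q : I q = `]inf (I q), sup (I q)[%classic.
  by rewrite {1}IE; apply/seteqP; split => x; rewrite /= in_itv.
have Isub q : I q `&` `]a, b] `<=` `]i q, s q].
  move=> x []; rewrite {1}IE /= !in_itv /= => /andP[h1 h2] /andP[h3 h4].
  by rewrite /i /s gt_max h1 h3 le_min h4 ltW.
have mI q : measurable (I q) by rewrite IE'; exact: measurable_itv.
have ai q : a <= i q by rewrite /i le_max lexx.
have sb q : s q <= b by rewrite /s ge_min lexx.
pose t := [seq (s q, i q) | q <- index_iota 0 n & i q < s q].
have dt : disj_itvs a b t.
  apply/andP; split.
    apply/allP => x /mapP[q]; rewrite mem_filter => /andP[isq _] ->.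
    by rewrite /subitv /= ai sb isq.
  rewrite /t pairwise_map.
  have : uniq [seq q <- index_iota 0 n | i q < s q].
    by rewrite filter_uniq// iota_uniq.
  rewrite uniq_pairwise; apply: sub_in_pairwise (filter_all _ _).
  move=> q r iq ir /= qr; rewrite !unfold_in /= in iq ir.
  have disj x : I q x -> I r x -> False.
    move=> qx rx; apply: (negP qr); apply/eqP; apply: tI => //.
    by exists x.
  rewrite /itv_apart /= leNgt [s r <= _]leNgt -negb_and; apply/negP.
  move=> /andP[h1 h2].
  (* The midpoint of an overlap of two traces would belong to two disjoint components. *)
  pose l := Num.max (i q) (i r); pose u := Num.min (s q) (s r).
  have lu : l < u.
    by rewrite gt_max; apply/andP; split; rewrite lt_min; apply/andP; split.
  have [m1 m2] := midf_lt lu.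
  apply: (disj ((l + u) / 2)); rewrite IE /=; move: m1 m2; set m := _ / 2.
    rewrite /l /u /i /s !gt_max !lt_min -!andbA.
    by move=> /and4P[_ -> _ _] /and4P[_ -> _ _].
  rewrite /l /u /i /s !gt_max !lt_min -!andbA.
  by move=> /and4P[_ _ _ ->] /and4P[_ _ _ ->].
have lt_ : \sum_(q <- t) (q.1 - q.2) < d.
  rewrite -lte_fin; apply: le_lt_trans Id.
  rewrite big_map big_filter /=.
  rewrite measure_bigcup//=; last by move=> k _; exact: mI.
  apply: (@le_trans _ _ (\sum_(0 <= q < n) lebesgue_measure (I q))%E); last first.
    have := @nneseries_lim_ge R (fun q => lebesgue_measure (I q)) xpredT 0 n.
    rewrite /eseries /=.
    under [in X in _ -> (_ <= X)%E]eq_eseriesl do rewrite in_setT.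
    by apply.
  rewrite big_mkcond -sumEFin; apply: lee_sum => q _.
  have -> : lebesgue_measure (I q) =
      if inf (I q) < sup (I q) then (sup (I q) - inf (I q))%:E else 0%E.
    by rewrite {1}IE' lebesgue_measure_itv /= lte_fin EFinB.
  case: ifPn => h; last by case: ifPn => // h'; rewrite lee_fin subr_ge0 ltW.
  have -> : inf (I q) < sup (I q).
    by move: h; rewrite /i /s gt_max !lt_min => /andP[/andP[_ _] /andP[_ ->]].
  by rewrite lee_fin lerB// /i /s ?ge_min ?le_max ?lexx ?orbT.
have := Hd _ dt lt_; rewrite -lee_fin; apply: le_trans.
rewrite big_map big_filter /= -(big_mkord xpredT (fun q => lsm (I q `&` `]a, b]))).
rewrite [X in (_ <= X%:E)%E]big_mkcond -sumEFin; apply: lee_sum => q _.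
case: ifPn => h.
  rewrite -lsm_itv//; last exact: ltW.
  apply: le_measure; rewrite ?inE//.
  by apply: measurableI => //; exact: mI.
rewrite (_ : _ `&` _ = set0) ?measure0//; apply/seteqP; split => // x /Isub.
by rewrite /= in_itv /= => /andP[/lt_le_trans /[apply]]; rewrite (negbTE h).
Qed.

Let nu : {finite_measure set (measurableTypeR R) -> \bar R} := mfrestr mab lsm_fin.

(** A null set lies in an open set of length below [d]. The components of that set have Stieltjes
    measure at most [e] in every finite sum, hence in total. *)
Let nu_dom : nu `<< (@lebesgue_measure R).
Proof.
move=> N N0 A mA AN; have A0 := N0 A mA AN.
rewrite /nu /= /mfrestr /mrestr /=.
apply/eqP; rewrite eq_le measure_ge0 andbT; apply/lee_addgt0Pr => e e0.
rewrite add0e; have [d d0 Hd] := cover_bound _ e0.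
have mA' : measurable (A `&` `]a, b]) by exact: measurableI.
have A'0 : lebesgue_measure (A `&` `]a, b]) = 0%E by exact: N0 _ mA' (subset_trans (@subIsetl _ _ _) AN).
have [|U [oU AU Ud]] := lebesgue_regularity_outer mA' _ d0.
  by apply: (@le_lt_trans _ _ 0%E) => //; rewrite le_eqVlt; apply/orP; left; apply/eqP.
pose V := U `&` `]a - 1, b + 1[.
have oV : open V by apply: openI => //; exact: interval_open.
have Vd : (lebesgue_measure V < d%:E)%E.
  apply: le_lt_trans Ud.
  have UE : lebesgue_measure (U `\` (A `&` `]a, b])) = lebesgue_measure U.
    rewrite -[in RHS](setDUK AU) setUC measureU0//.
    by apply: measurableD => //; exact: open_measurable.
  apply: (@le_trans _ _ (lebesgue_measure U)); last first.
    by rewrite le_eqVlt; apply/orP; left; apply/eqP; exact/esym/UE.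
  apply: le_measure; rewrite ?inE; [exact: open_measurable|exact: open_measurable|].
  exact: subIsetl.
pose I := open_disjoint_itv oV.
have IV : V = \bigcup_q I q := open_disjoint_itv_bigcup oV.
have PI q : open (I q) /\ is_interval (I q) /\ I q `<=` `]a - 1, b + 1[.
  split; first exact: open_disjoint_itv_open.
  split; first exact: open_disjoint_itv_is_interval.
  move=> x Iqx; have : V x by rewrite IV; exists q.
  by case.
have K : (forall n, \sum_(q < n) lsm (I q `&` `]a, b]) <= e%:E)%E.
  by apply: Hd => //; [exact: open_disjoint_itv_trivIset|rewrite -IV].
apply: (@le_trans _ _ (\sum_(q <oo) lsm (I q `&` `]a, b]))%E).
  apply: measure_sigma_subadditive => //.
    by move=> q; apply: measurableI => //; apply: open_measurable; have [] := PI q.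
  move=> x Ax; have [_ xab] := Ax; have Ux := AU _ Ax.
  have : V x.
    split => //; move: xab; rewrite /= !in_itv /= => /andP[? ?].
    by apply/andP; split; lra.
  by rewrite IV => -[q _ Iqx]; exists q.
apply: lime_le; first by apply: is_cvg_nneseries => *; exact: measure_ge0.
by apply: nearW => n; rewrite big_mkord.
Qed.

Lemma stieltjes_density : exists h : R -> R,
  (@lebesgue_measure R).-integrable setT (EFin \o h) /\
  forall x, a <= x <= b -> (H x - H a)%:E =
    (\int[lebesgue_measure]_(t in `]a, x]) (h t)%:E)%E.
Proof.
have [f [f0 ffin intf fE]] := radon_nikodym_sigma_finite nu_dom.
exists (fine \o f).
have fK : EFin \o (fine \o f) = f by apply/funext => x /=; rewrite fineK.
rewrite fK; split => // x /andP[ax xb].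
under eq_integral do rewrite fineK//.
rewrite -fE; last exact: measurable_itv.
rewrite /nu /= /mfrestr /mrestr -lsm_itv// setIidl//.
by move=> y; rewrite /= !in_itv /= => /andP[-> /le_trans ->].
Qed.

End density.

(** Jordan decomposition: [f] is the difference of its variation function [F] and of [F \- f]. Both
    are nondecreasing, and both inherit absolute continuity from [abs_cont_TV], the second because
    its increments are at most twice those of [F]. *)
Lemma abs_cont_primitive a b f : a < b -> abs_cont_on a b f ->
  exists h : R -> R, (@lebesgue_measure R).-integrable setT (EFin \o h) /\
  forall x, a <= x <= b -> (f x - f a)%:E =
    (\int[lebesgue_measure]_(t in `]a, x]) (h t)%:E)%E.
Proof.
move=> ab acf.
have bv := abs_cont_bounded_variation _ _ _ (ltW ab) acf.
have tvf x y : a <= x -> x <= y -> y <= b -> TV x y f \is a fin_num.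
  move=> ax xy yb; apply/bounded_variationP => //.
  apply: (bounded_variationl xy yb).
  by apply: bounded_variationr bv => //; exact: le_trans yb.
pose F x := fine (TV a x f).
have FB x y : a <= x -> x <= y -> y <= b -> F y - F x = fine (TV x y f).
  move=> ax xy yb; rewrite /F (total_variationD f ax xy) fineD ?tvf//.
    by rewrite addrAC subrr add0r.
  exact: le_trans yb.
have fF x y : a <= x -> x <= y -> y <= b -> `|f y - f x| <= F y - F x.
  move=> ax xy yb; rewrite FB// -lee_fin fineK ?tvf//.
  exact: total_variation_ge.
have acF (e : R) : 0 < e -> exists2 d : R, 0 < d &
    forall s, disj_itvs a b s -> \sum_(q <- s) (q.1 - q.2) < d ->
      \sum_(q <- s) (F q.1 - F q.2) <= e.
  move=> e0; have [d d0 Hd] := abs_cont_TV _ _ _ acf _ e0; exists d => // s ss sd.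
  have := Hd s ss sd; rewrite -lee_fin; apply: le_trans.
  rewrite -sumEFin big_seq [X in (_ <= X)%E]big_seq; apply: lee_sum => q qs.
  have /andP[/allP/(_ _ qs)/and3P[aq /ltW qq qb] _] := ss.
  by rewrite FB// fineK// tvf.
have [|hF [iF FE]] := stieltjes_density a b F ab _ acF.
  move=> x y; rewrite !in_itv/= => /andP[ax xb] /andP[ay yb] xy.
  by rewrite -subr_ge0; apply: le_trans (fF _ _ _ _ _).
have [||hG [iG GE]] := stieltjes_density a b (F \- f) ab.
- move=> x y; rewrite !in_itv/= => /andP[ax xb] /andP[ay yb] xy.
  have := le_trans (ler_norm _) (fF _ _ ax xy yb); lra.
- move=> e e0; have [|d d0 Hd] := acF (e / 2); first by rewrite divr_gt0.
  exists d => // s ss sd.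
  apply: (@le_trans _ _ (\sum_(q <- s) 2 * (F q.1 - F q.2))); last first.
    by rewrite -mulr_sumr mulrC -ler_pdivlMr// Hd.
  rewrite big_seq [leRHS]big_seq; apply: ler_sum => q qs.
  have /andP[/allP/(_ _ qs)/and3P[aq /ltW qq qb] _] := ss.
  have := fF _ _ aq qq qb; rewrite ler_norml => /andP[+ _] /=; lra.
exists (hF \- hG); split.
  rewrite (_ : _ \o _ = (EFin \o hF) \- (EFin \o hG))%E; first exact: integrableB.
  by apply/funext => x /=; rewrite EFinB.
move=> x xab; have mx : measurable (`]a, x]%classic : set R) by exact: measurable_itv.
under eq_integral do rewrite EFinB.
rewrite integralB//; [|exact: integrableS iF|exact: integrableS iG].
by rewrite -FE// -GE//= -EFinB; congr EFin; ring.
Qed.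

(** Lebesgue differentiation of the primitive identifies its density with [derive1 f] almost
    everywhere; the points where [f] has no derivative form a null set. *)
Lemma abs_cont_le_integral_derive1 a b f : a < b -> abs_cont_on a b f ->
  measurable_fun `]a, b[ (derive1 f) ->
  (`|f b - f a|%:E <= \int[lebesgue_measure]_(x in `]a, b[) `|derive1 f x|%:E)%E.
Proof.
move=> ab acf mf'; have [h [ih fE]] := abs_cont_primitive _ _ _ ab acf.
have mh : measurable_fun setT h by have /integrableP[/measurable_EFinP] := ih.
have h' : {ae lebesgue_measure, forall x, x \in `]a, b[ -> derive1 f x = h x}.
  pose F x := (\int[lebesgue_measure]_(t in `]a, x]) (h t))%R.
  have i1 y : lebesgue_measure.-integrable [set` Interval (BRight a) (BRight y)] (EFin \o h).
    by apply: integrableS ih => //; exact: measurable_itv.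
  have i2 : locally_integrable [set: R] h.
    by apply: open_integrable_locally => //; exact: openT.
  have := FTC1 i1 i2; apply: filterS; first exact: (ae_filter_ringOfSetsType lebesgue_measure).
  move=> x Fx; rewrite in_itv /= => /andP[ax xb].
  have [|dF <-] := Fx; first exact: ax.
  have E : \forall y \near x, F y + f a = f y.
    near=> y; rewrite /F /Rintegral -fE /= ?subrK//.
    by apply/andP; split; apply: ltW; near: y; [exact: lt_nbhsr|exact: lt_nbhsl].
  have dc : derivable (cst (f a) : R -> R) x 1 by exact: derivable_cst.
  rewrite [LHS]derive1E -[LHS](near_eq_derive _ E).
  by rewrite (deriveD dF dc) derive_cst addr0 -derive1E.
have -> : (\int[lebesgue_measure]_(x in `]a, b[) `|derive1 f x|%:E =
           \int[lebesgue_measure]_(x in `]a, b[) `|h x|%:E)%E.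
  apply: ae_eq_integral => //.
  - by apply/measurable_EFinP; exact: measurableT_comp.
  - by apply/measurable_EFinP; apply: measurableT_comp => //; exact: measurable_funS mh.
  - apply: filterS h'; first exact: (ae_filter_ringOfSetsType lebesgue_measure).
    move=> x /= + xab => -> //; rewrite inE.
rewrite integral_itv_bndo_bndc; last first.
  by apply/measurable_EFinP; apply: measurableT_comp => //; exact: measurable_funS mh.
rewrite -abse_EFin fE; last by rewrite lexx ltW.
apply: le_abse_integral => //.
by apply/measurable_EFinP; exact: measurable_funS mh.
Unshelve. all: by end_near. Qed.

End AbsCont.

(** * Elementary inequalities *)

Section RealIneq.
Variable R : realType.
Implicit Types (p q x y z s t r kap : R).

Lemma le_powR2 r x y : 0 <= r -> 0 <= x -> x <= y -> x `^ r <= y `^ r.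
Proof.
move=> r0 x0 xy; apply: ge0_ler_powR => //; rewrite nnegrE//.
exact: le_trans xy.
Qed.

Lemma one_powR r : 1 `^ r = 1 :> R.
Proof. by rewrite powR1. Qed.

Lemma powRK x r : 0 <= x -> r != 0 -> (x `^ r^-1) `^ r = x.
Proof. by move=> x0 r0; rewrite -powRrM mulVf// powRr1. Qed.

(** The coefficient of x^p can be as close to 1 as desired, at the price of [C]; this stands in for
    Minkowski's inequality below. The number [d] solves (1 + d)^p = 1 + kap, and the cases are y <=
    d x and y > d x. *)
Lemma powRD_le p kap : 0 < p -> 0 < kap -> exists2 C : R, 0 <= C &
  forall x y, 0 <= x -> 0 <= y ->
    (x + y) `^ p <= (1 + kap) * x `^ p + C * y `^ p.
Proof.
move=> p0 k0; pose d := (1 + kap) `^ p^-1 - 1.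
have k1 : 1 < 1 + kap by rewrite ltrDl.
have d0 : 0 < d.
  rewrite subr_gt0 -[ltLHS](one_powR p^-1); apply: gt0_ltr_powR => //.
  - by rewrite invr_gt0.
  - by rewrite nnegrE.
  - by rewrite nnegrE ltW// (lt_trans _ k1).
exists ((1 + d^-1) `^ p); first exact: powR_ge0.
move=> x y x0 y0; have [yx|xy] := leP y (d * x).
  apply: (@le_trans _ _ ((1 + kap) * x `^ p)); last first.
    by rewrite lerDl mulr_ge0 ?powR_ge0.
  rewrite -[X in X * _ `^ _](@powRK _ p) ?gt_eqF//; last by rewrite ltW// (lt_trans _ k1).
  rewrite -powRM ?powR_ge0//; apply: le_powR2; [exact: ltW|exact: addr_ge0|].
  have -> : (1 + kap) `^ p^-1 = 1 + d by rewrite /d; ring.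
  by rewrite mulrDl mul1r lerD2l.
apply: (@le_trans _ _ ((1 + d^-1) `^ p * y `^ p)); last first.
  by rewrite lerDr mulr_ge0 ?powR_ge0// ltW// (lt_trans _ k1).
rewrite -powRM ?addr_ge0 ?invr_ge0 ?(ltW d0)//.
apply: le_powR2; [exact: ltW|exact: addr_ge0|].
by rewrite mulrDl mul1r addrC lerD2l ler_pdivlMl// ltW.
Qed.

Lemma bernoulli_le n x : 0 <= x -> x <= 1 -> 1 - n%:R * x <= (1 - x) ^+ n.
Proof.
move=> x0 x1; elim: n => [|n ih]; first by rewrite mul0r subr0 expr0.
rewrite exprS; apply: (@le_trans _ _ ((1 - x) * (1 - n%:R * x))).
  have := mulr_ge0 (mulr_ge0 (ler0n R n) x0) x0; rewrite -natr1; nra.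
by rewrite ler_wpM2l// subr_ge0.
Qed.

Lemma exprD1_le n x : 0 <= x -> x <= 1 -> (1 + x) ^+ n <= 1 + (2 ^+ n - 1) * x.
Proof.
move=> x0 x1; elim: n => [|n ih]; first by rewrite !expr0 subrr mul0r addr0.
have c0 : 0 <= 2 ^+ n - 1 :> R by rewrite subr_ge0 exprn_ege1// ler1n.
rewrite !exprS; apply: le_trans (_ : (1 + x) * (1 + (2 ^+ n - 1) * x) <= _).
  by rewrite ler_wpM2l// addr_ge0.
have : (2 ^+ n - 1) * (x * x) <= (2 ^+ n - 1) * x.
  by rewrite ler_wpM2l// ler_piMl.
set c := _ ^+ n in c0 *; nra.
Qed.

(** For z <= 1 the exponent is raised to an integer and the chord over [0, 1] dominates; for z > 1
    one has 1 + z <= 2 z. *)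
Lemma powRD1_le q : 0 < q -> exists2 C : R, 1 <= C &
  forall z, 0 <= z -> (1 + z) `^ q <= 1 + C * (z + z `^ q).
Proof.
move=> q0; pose n := Num.bound q; exists (2 ^+ n).
  by rewrite exprn_ege1// ler1n.
have qn : q <= n%:R by apply: ltW; apply: archi_boundP; exact: ltW.
move=> z z0; have [z1|z1] := leP z 1.
  apply: (@le_trans _ _ ((1 + z) ^+ n)).
    by rewrite -powR_mulrn ?addr_ge0// ler_powR// lerDl.
  apply: le_trans (exprD1_le n _ z0 z1) _; rewrite lerD2l mulrDr.
  rewrite mulrBl mul1r lerD2l (@le_trans _ _ 0) ?oppr_le0//.
  by rewrite mulr_ge0 ?powR_ge0// exprn_ge0.
apply: (@le_trans _ _ (2 ^+ n * z `^ q)); last first.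
  by rewrite mulrDr addrA lerDr addr_ge0// mulr_ge0// exprn_ge0.
apply: (@le_trans _ _ ((2 * z) `^ q)).
  by apply: le_powR2; [exact: ltW|exact: addr_ge0|lra].
rewrite powRM// ler_wpM2r ?powR_ge0// -powR_mulrn// ler_powR//.
by rewrite ler1n.
Qed.

Lemma conj_exp_div p : 1 < p -> (p / (p - 1))^-1 = 1 - p^-1.
Proof.
by move=> p1; field; rewrite !gt_eqF ?subr_gt0//; lra.
Qed.

(* Moser's observation: if [w^q] is within [s] of its upper bound [t] at two
   points, most of the energy [a + b <= 1] is spent before the first one. *)
Lemma moser_pair p : 1 < p -> let q := p / (p - 1) in exists2 K : R, 1 <= K &
  forall s t1 D a b w1 w2 : R, 0 < s -> K * s <= t1 -> 0 <= D ->
    0 <= a -> 0 <= b -> a + b <= 1 -> 0 <= w1 -> 0 <= w2 ->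
    w1 <= a `^ p^-1 * t1 `^ q^-1 -> w2 <= w1 + b `^ p^-1 * D `^ q^-1 ->
    t1 - w1 `^ q <= s -> t1 + D - w2 `^ q <= s -> D <= K * s.
Proof.
move=> p1 q.
have p0 : 0 < p by lra.
have q0 : 0 < q by rewrite divr_gt0// subr_gt0.
have qN : q^-1 = 1 - p^-1 by rewrite conj_exp_div.
have qp : q / p = (p - 1)^-1.
  by rewrite /q; field; rewrite subr_eq0 !gt_eqF.
have [C C1 HC] := powRD1_le _ q0.
(* An integer above p - 1 gives Bernoulli's inequality for this real exponent: being close to its
   bound at [t1] forces a >= (1 - s / t1)^(p - 1) >= 1 - n s / t1. *)
pose n := Num.bound (p - 1).
have pn : p - 1 <= n%:R by apply: ltW; apply: archi_boundP; lra.
have n0 : 0 < n%:R :> R by lra.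
pose k : R := n%:R + 1.
have k0 : 0 < k by rewrite /k addr_gt0.
have C0 : 0 < C by exact: lt_le_trans C1.
have p10 : 0 < p - 1 by rewrite subr_gt0.
have pp1 : p - 1 <= p by rewrite gerBl.
(* The factor (4 C)^p makes (k / K)^(1/p) equal to 1 / (4 C). Each of the two error terms of [HC]
   then costs at most D / 4, and K s < D gives s < D / 4, which leaves less than [D] in all. *)
pose K := k * (4 * C) `^ p.
have C40 : 0 < 4 * C by lra.
have C4 : 4 <= 4 * C by lra.
have C4p : 4 <= (4 * C) `^ p.
  apply: le_trans C4 _; rewrite -[leLHS]powRr1; last lra.
  by rewrite ler_powR; lra.
have K4 : 4 <= K by rewrite -[4]mul1r; apply: ler_pM => //; rewrite /k; lra.
have K0 : 0 < K by lra.
have kK1 : k / K <= 1 by rewrite ler_pdivrMr// mul1r /K ler_peMr ?(ltW k0)//; lra.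
exists K; first by lra.
move=> s t1 D a b w1 w2 s0 Kt1 D0 a0 b0 ab w10 w20 Hw1 Hw2 d1 d2.
have t10 : 0 < t1 by apply: lt_le_trans Kt1; rewrite mulr_gt0//; lra.
rewrite leNgt; apply/negP => KD.
have D1 : 0 < D by apply: lt_trans KD; rewrite mulr_gt0//; lra.
have xE : (k / K) `^ p^-1 = (4 * C)^-1.
  rewrite /K invfM mulrA mulfV ?mul1r; last by rewrite gt_eqF.
  rewrite -powRN -powRrM mulNr mulfV ?gt_eqF//.
  by rewrite powR_inv1// ltW.
have kK0 : 0 < k / K by rewrite divr_gt0.
(* the energy left after [t1] *)
have bs : b <= k * s / t1.
  have st1 : s / t1 <= 1.
    rewrite ler_pdivrMr// mul1r; apply: le_trans Kt1; rewrite ler_peMl ?ltW//; lra.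
  have z0 : 0 <= s / t1 by rewrite divr_ge0// ltW.
  have h1 : w1 `^ q <= a `^ (p - 1)^-1 * t1.
    apply: le_trans (le_powR2 _ _ _ (ltW q0) w10 Hw1) _.
    rewrite powRM ?powR_ge0// -!powRrM mulVf ?gt_eqF// powRr1 ?(ltW t10)//.
    by rewrite [p^-1 * q]mulrC qp.
  have h2 : 1 - s / t1 <= a `^ (p - 1)^-1.
    rewrite -(ler_pM2r t10) mulrBl mul1r divfK ?gt_eqF//; lra.
  have h3 : (1 - s / t1) `^ (p - 1) <= a.
    rewrite -[leRHS](@powRK _ (p - 1)) ?gt_eqF ?subr_gt0//.
    by apply: le_powR2 h2; rewrite ?(ltW p10)// subr_ge0.
  have h4 : 1 - n%:R * (s / t1) <= (1 - s / t1) `^ (p - 1).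
    apply: le_trans (bernoulli_le n _ z0 st1) _.
    rewrite -powR_mulrn; last lra.
    have [->|ne] := eqVneq (1 - s / t1) 0.
      by rewrite !powR0 ?gt_eqF.
    by rewrite ger_powR//; lra.
  rewrite -mulrA /k; nra.
(* By [bs], [w2] exceeds t1^(1/q) at most by the factor 1 + z. *)
pose z := (k * s / t1) `^ p^-1 * (D / t1) `^ q^-1.
have z0 : 0 <= z by rewrite mulr_ge0 ?powR_ge0.
have w2z : w2 <= t1 `^ q^-1 * (1 + z).
  apply: le_trans Hw2 _; rewrite mulrDr mulr1; apply: lerD.
    apply: le_trans Hw1 _; rewrite ler_piMl ?powR_ge0//.
    rewrite -[leRHS](one_powR p^-1); apply: le_powR2 => //; first by rewrite invr_ge0 ltW.
    lra.
  rewrite /z mulrCA; apply: ler_pM; rewrite ?powR_ge0//.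
    by apply: le_powR2 => //; rewrite invr_ge0 ltW.
  rewrite -powRM ?(ltW t10)// ?divr_ge0 ?(ltW t10)//.
  by rewrite mulrC divfK// gt_eqF.
have w2q : w2 `^ q <= t1 * (1 + C * (z + z `^ q)).
  apply: le_trans (le_powR2 _ _ _ (ltW q0) w20 w2z) _.
  rewrite powRM ?powR_ge0 ?addr_ge0// powRK ?gt_eqF ?(ltW t10)//.
  by rewrite ler_wpM2l ?HC// ltW.
have tz : t1 * z <= (4 * C)^-1 * D.
  rewrite -xE /z.
  apply: (@le_trans _ _ (t1 * ((k / K * (D / t1)) `^ p^-1 * (D / t1) `^ q^-1))).
    rewrite ler_wpM2l ?(ltW t10)// ler_wpM2r ?powR_ge0//.
    apply: le_powR2; [by rewrite invr_ge0 ltW| |].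
      by rewrite divr_ge0 ?mulr_ge0 ?(ltW k0) ?(ltW s0) ?(ltW t10).
    rewrite mulrA ler_wpM2r ?invr_ge0 ?(ltW t10)//.
    rewrite -[k / K * D]mulrA ler_pM2l//.
    by rewrite ler_pdivlMl// ltW.
  rewrite powRM ?(ltW kK0) ?divr_ge0 ?(ltW t10)// -mulrA -powRD; last first.
    by apply/implyP => _; rewrite gt_eqF// divr_gt0.
  rewrite qN addrC subrK powRr1; last by rewrite divr_ge0// ltW.
  by rewrite mulrCA [t1 * _]mulrC divfK// gt_eqF.
have tzq : t1 * z `^ q <= (4 * C)^-1 * D.
  rewrite /z powRM ?powR_ge0// powRK ?gt_eqF// ?divr_ge0 ?(ltW D1) ?(ltW t10)//.
  rewrite mulrCA [t1 * _]mulrC divfK ?gt_eqF// ler_wpM2r// -powRrM.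
  apply: (@le_trans _ _ ((k / K) `^ (p^-1 * q))).
    apply: le_powR2; first by rewrite mulr_ge0 ?invr_ge0 ?(ltW p0) ?(ltW q0).
      by rewrite divr_ge0 ?mulr_ge0 ?(ltW k0) ?(ltW s0) ?(ltW t10).
    rewrite -mulrA ler_pM2l//.
    by rewrite ler_pdivrMr// ler_pdivlMl.
  rewrite -xE ger_powR//.
    by rewrite kK0.
  by rewrite mulrC qp lef_pV2 ?posrE.
have h5 : C * (t1 * z) <= 4^-1 * D.
  apply: le_trans (_ : C * ((4 * C)^-1 * D) <= _); first by rewrite ler_pM2l.
  by rewrite invfM mulrA mulrCA mulfV ?mulr1// gt_eqF.
have h6 : C * (t1 * z `^ q) <= 4^-1 * D.
  apply: le_trans (_ : C * ((4 * C)^-1 * D) <= _); first by rewrite ler_pM2l.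
  by rewrite invfM mulrA mulrCA mulfV ?mulr1// gt_eqF.
have h7 : 4 * s < D by apply: le_lt_trans KD; rewrite ler_pM2r.
have h8 : t1 * (1 + C * (z + z `^ q)) = t1 + C * (t1 * z) + C * (t1 * z `^ q) by ring.
rewrite h8 in w2q; clear -d2 w2q h5 h6 h7 D1 s0; lra.
Qed.

End RealIneq.

(** * Weighted integrals *)

Section Integral.
Variable R : realType.
Implicit Types (D : set R) (h k f F : R -> R) (a b p x : R).
Notation mu := (@lebesgue_measure R).

Lemma measurable_fun_normpow D h p c s : measurable_fun D h ->
  measurable_fun D (fun x => `|h x| `^ p * (c * x `^ s)).
Proof.
move=> mh; apply: measurable_funM.
  apply: (measurableT_comp (measurable_powR p)).
  exact: measurableT_comp.
apply: measurable_funM => //.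
exact: measurable_funS (measurable_powR s).
Qed.

(** Hoelder's inequality for the product of |h| k^(1/p) and k^(-1/p), both extended by zero outside
    [D]; the dual weight k^(-q/p) is k^(-1/(p-1)). *)
Lemma hoelder_weight D h k p (A B : R) : 1 < p -> measurable D ->
  measurable_fun D h -> measurable_fun D k -> (forall x, D x -> 0 < k x) ->
  0 <= A -> 0 <= B ->
  (\int[mu]_(x in D) (`|h x| `^ p * k x)%:E <= A%:E)%E ->
  (\int[mu]_(x in D) (k x `^ (- (p - 1)^-1))%:E <= B%:E)%E ->
  (\int[mu]_(x in D) `|h x|%:E <= (A `^ p^-1 * B `^ (1 - p^-1))%:E)%E.
Proof.
move=> p1 mD mh mk k0 A0 B0 hA hB.
have p0 : 0 < p by lra.
pose q := p / (p - 1).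
have q0 : 0 < q by rewrite divr_gt0// subr_gt0.
have qN : q^-1 = 1 - p^-1 by rewrite conj_exp_div.
pose f := (fun x => `|h x| * k x `^ p^-1) \_ D.
pose g := (fun x => k x `^ (- p^-1)) \_ D.
have mf : measurable_fun setT f.
  have mf0 : measurable_fun D (fun x => `|h x| * k x `^ p^-1).
    apply: measurable_funM; first exact: measurableT_comp.
    exact: (measurableT_comp (measurable_powR _)).
  exact: (measurable_restrictT _ mD).1 mf0.
have mg : measurable_fun setT g.
  have mg0 : measurable_fun D (fun x => k x `^ (- p^-1)).
    exact: (measurableT_comp (measurable_powR _)).
  exact: (measurable_restrictT _ mD).1 mg0.
have := @hoelder _ _ R mu f g p q mf mg p0 q0 _; rewrite qN addrC subrK => /(_ erefl).
rewrite Lnorm.unlock invr1 poweRe1; last by apply: integral_ge0 => *; exact: poweR_ge0.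
have -> : (\int[mu]_x `|(EFin \o (f \* g)%R) x| `^ 1 = \int[mu]_(x in D) `|h x|%:E)%E.
  rewrite [RHS]integral_mkcond; apply: eq_integral => x _.
  rewrite poweRe1// /f /g /= !patchE; case: ifPn => [xD|_]; last by rewrite mul0r normr0.
  rewrite -mulrA -powRD; last first.
    by apply/implyP => _; rewrite gt_eqF// k0// -in_setE.
  by rewrite subrr powRr0 mulr1 normr_id.
have -> : (\int[mu]_x `|(EFin \o f) x| `^ p = \int[mu]_(x in D) (`|h x| `^ p * k x)%:E)%E.
  rewrite [RHS]integral_mkcond; apply: eq_integral => x _.
  rewrite /f /= !patchE; case: ifPn => [xD|_]; last first.
    by rewrite normr0 powR0// gt_eqF.
  have kx := k0 x (set_mem xD).
  by rewrite ger0_norm ?mulr_ge0 ?powR_ge0// powRM ?powR_ge0// powRK ?ltW// gt_eqF.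
have -> : (\int[mu]_x `|(EFin \o g) x| `^ q = \int[mu]_(x in D) (k x `^ (- (p - 1)^-1))%:E)%E.
  rewrite [RHS]integral_mkcond; apply: eq_integral => x _.
  rewrite /g /= !patchE; case: ifPn => [xD|_]; last first.
    by rewrite normr0 powR0// gt_eqF.
  rewrite ger0_norm ?powR_ge0// -powRrM /q mulNr mulrA mulVf ?mul1r//.
  by rewrite gt_eqF.
move=> /le_trans; apply; rewrite EFinM; apply: lee_pmul; rewrite ?poweR_ge0// -poweR_EFin.
  apply: gt0_ler_poweR; rewrite ?invr_ge0 ?(ltW p0)//.
  - rewrite in_itv /= leey andbT; apply: integral_ge0 => x Dx.
    by rewrite lee_fin mulr_ge0 ?powR_ge0// ltW// k0.
  - by rewrite in_itv /= leey andbT lee_fin.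
rewrite qN; apply: gt0_ler_poweR => //; first by rewrite -qN invr_ge0 ltW.
- by rewrite in_itv /= leey andbT; apply: integral_ge0 => x Dx; rewrite lee_fin powR_ge0.
- by rewrite in_itv /= leey andbT lee_fin.
Qed.

Lemma integral_oo_derive F f a b : a < b ->
  (forall x, a <= x <= b -> is_derive x 1 F (f x)) ->
  (forall x, a <= x <= b -> {for x, continuous f}) ->
  (\int[mu]_(x in `]a, b[) (f x)%:E = (F b - F a)%:E)%E.
Proof.
move=> ab dF cf.
have cF x : a <= x <= b -> {for x, continuous F}.
  move=> /dF [dFx _]; apply: differentiable_continuous; exact/derivable1_diffP.
have mf : measurable_fun `]a, b[ f.
  apply: open_continuous_measurable_fun; first exact: interval_open.
  by move=> x; rewrite inE /= in_itv /= => /andP[/ltW ? /ltW ?]; apply: cf; apply/andP.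
rewrite -(integral_itv_bndoo true false); last exact/measurable_EFinP.
rewrite (@continuous_FTC2 _ f F)//.
- apply: continuous_in_subspaceT => x; rewrite inE /= in_itv /= => xab.
  exact: cf.
- split.
  + by move=> x; rewrite in_itv /= => /andP[/ltW ? /ltW ?]; have [] := dF x; first exact/andP.
  + by apply: cvg_at_right_filter; apply: cF; rewrite lexx ltW.
  + by apply: cvg_at_left_filter; apply: cF; rewrite lexx ltW.
- move=> x; rewrite in_itv /= => /andP[/ltW ? /ltW ?].
  by rewrite derive1E; apply: derive_val; apply: dF; apply/andP.
Qed.

Lemma integral_oo_cst a b c : a <= b ->
  (\int[mu]_(x in `]a, b[) c%:E = (c * (b - a))%:E)%E.
Proof.
move=> ab; rewrite integral_cst/=; last exact: measurable_itv.
rewrite lebesgue_measure_itv /= lte_fin.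
case: ltP => ba; first by rewrite -EFinB -EFinM.
have -> : b = a by apply/eqP; rewrite eq_le ba.
by rewrite subrr mulr0 mule0.
Qed.

Lemma integral_inv_add a b c : 0 < a -> a <= b ->
  (\int[mu]_(x in `]a, b[) (x^-1 + c)%:E = (ln b - ln a + c * (b - a))%:E)%E.
Proof.
move=> a0; rewrite le_eqVlt => /predU1P[<-|ab].
  by rewrite set_itv_ge ?integral_set0 ?bnd_simp -?leNgt// !subrr mulr0 addr0.
transitivity ((ln b + c * b - (ln a + c * a))%:E); last by congr EFin; ring.
apply: (integral_oo_derive (fun x => ln x + c * x) (fun x => x^-1 + c)) => //.
- move=> x /andP[ax _]; have x0 : 0 < x by exact: lt_le_trans ax.
  have := is_derive1_ln x0 => ?.
  by apply: is_derive_eq; rewrite /GRing.scale /= mulr1.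
- move=> x /andP[ax _]; have x0 : x != 0 by rewrite gt_eqF// (lt_le_trans a0).
  by apply: cvgD; [exact: cvgV|exact: cvg_cst].
Qed.

Lemma integral_invXn2_le a b : 0 < a -> a <= b ->
  (\int[mu]_(x in `]a, b[) (x `^ (-2))%:E <= (a^-1)%:E)%E.
Proof.
move=> a0; rewrite le_eqVlt => /predU1P[<-|ab].
  by rewrite set_itv_ge ?integral_set0 ?bnd_simp -?leNgt// lee_fin invr_ge0 ltW.
have xp x : a <= x <= b -> 0 < x by move=> /andP[ax _]; exact: lt_le_trans ax.
apply: (@le_trans _ _ (- b^-1 - - a^-1)%:E); last first.
  by rewrite lee_fin opprK addrC lerBlDr lerDl invr_ge0 ltW// (lt_trans a0).
rewrite le_eqVlt; apply/orP; left; apply/eqP.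
apply: (integral_oo_derive (fun x => - x^-1) (fun x => x `^ (-2))) => //.
- move=> x /xp x0; have x0' : x != 0 by rewrite gt_eqF.
  have ? := is_deriveV (f := id) x0' (is_derive_id x 1).
  apply: is_derive_eq; rewrite /GRing.scale /= mulr1 opprK.
  by rewrite powRN -powR_mulrn ?ltW.
- move=> x /xp x0; apply: differentiable_continuous; apply/derivable1_diffP.
  by have [] := is_derive1_powR (-2) x0.
Qed.

Lemma ge0_integral_split a b c (f : R -> \bar R) : a < b -> b < c ->
  measurable_fun `]a, c[ f -> (forall x, (a < x < c)%R -> 0 <= f x)%E ->
  (\int[mu]_(x in `]a, c[) f x =
   \int[mu]_(x in `]a, b[) f x + \int[mu]_(x in `]b, c[) f x)%E.
Proof.
move=> ab bc mf f0.
have E : `]a, c[%classic = `]a, b]%classic `|` `]b, c[%classic :> set R.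
  apply/seteqP; split => x /=; rewrite !in_itv /=.
    by move=> /andP[-> ->]; case: (leP x b); [left|right].
  by move=> [/andP[-> xb]|/andP[bx ->]]; rewrite ?(le_lt_trans xb) ?(lt_trans ab).
rewrite E ge0_integral_setU -?E//.
- rewrite integral_itv_bndo_bndc//; apply: measurable_funS mf => // x /=.
  by rewrite !in_itv /= => /andP[-> /lt_trans ->].
- apply/disj_setPS => x [] /=; rewrite !in_itv /= => /andP[_ xb] /andP[bx _].
  by move: (lt_le_trans bx xb); rewrite ltxx.
Qed.

Lemma abs_cont_hoelder v k p a b (A B : R) : 1 < p -> a < b ->
  abs_cont_on a b v -> measurable_fun `]a, b[ (derive1 v) ->
  measurable_fun `]a, b[ k -> (forall x, a < x < b -> 0 < k x) ->
  0 <= A -> 0 <= B ->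
  (\int[mu]_(x in `]a, b[) (`|derive1 v x| `^ p * k x)%:E <= A%:E)%E ->
  (\int[mu]_(x in `]a, b[) (k x `^ (- (p - 1)^-1))%:E <= B%:E)%E ->
  `|v b - v a| <= A `^ p^-1 * B `^ (1 - p^-1).
Proof.
move=> p1 ab acv mv' mk k0 A0 B0 hA hB.
rewrite -lee_fin; apply: le_trans (abs_cont_le_integral_derive1 _ _ _ _ ab acv mv') _.
apply: hoelder_weight hA hB => // x; rewrite /= in_itv /=; exact: k0.
Qed.

End Integral.

(** * Truncation near the origin *)

Section Truncation.
Variable R : realType.
Implicit Types (v u g : R -> R) (a p s th Rad : R).
Notation mu := (@lebesgue_measure R).

Lemma omega_ge0 s : 0 <= omega s.
Proof.
rewrite /omega divr_ge0 ?mulr_ge0 ?powR_ge0//; apply: fine_ge0.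
apply: integral_ge0 => x _; rewrite lee_fin mulr_ge0 ?powR_ge0 ?expR_ge0//.
Qed.

Lemma wint_ge0 s Rad f : (forall x, 0 <= f x) -> (0 <= wint s Rad f)%E.
Proof.
move=> f0; apply: integral_ge0 => x _.
by rewrite lee_fin mulr_ge0// mulr_ge0 ?omega_ge0 ?powR_ge0.
Qed.

Lemma Lpnp_ge0 p s Rad f : (0 <= Lpnp p s Rad f)%E.
Proof. by apply: wint_ge0 => x; exact: powR_ge0. Qed.

Lemma inLp_fin_num p s Rad f : inLp p s Rad f -> Lpnp p s Rad f \is a fin_num.
Proof. by move=> [_ f_fin]; rewrite ge0_fin_numE// Lpnp_ge0. Qed.

(** Freezing the value on (0, a] removes all energy there, so the definition of lambda bounds the
    truncated function by the energy beyond [a] alone. *)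
Definition trunc a v := fun r => v (Num.max a r).

Lemma AC_loc_trunc Rad v a : 0 < a -> a < Rad -> AC_loc Rad v ->
  AC_loc Rad (trunc a v).
Proof.
move=> a0 aR acv A B A0 AB BR e e0.
have [||| d d0 Hd] := acv (Num.min A a) (Num.max B a) _ _ _ e e0.
- by rewrite lt_min A0.
- by rewrite lt_max gt_min AB.
- by rewrite gt_max BR.
exists d => // n x y xy yx sd.
apply: (Hd n (fun i => Num.max a (x i)) (fun i => Num.max a (y i))).
- move=> i /xy[Ax [xyi yB]]; split; first by rewrite le_max ge_min lexx orbT.
  split; first by rewrite ge_max !le_max lexx xyi orbT.
  by rewrite ge_max !le_max lexx yB orbT.
- by move=> i /yx h; rewrite ge_max !le_max lexx h orbT.
- apply: le_lt_trans sd; apply: ler_sum => i _.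
  have [_ [xyi _]] := xy i (ltn_ord i).
  by rewrite /Order.max; do 2 case: ifPn; rewrite -?leNgt; lra.
Qed.

Lemma derive1_trunc_lt a v x : x < a -> derive1 (trunc a v) x = 0.
Proof.
move=> xa; have E : \near x, cst (v a) x = trunc a v x.
  by near=> y; rewrite /trunc max_l//; apply: ltW; near: y; exact: lt_nbhsl.
by rewrite derive1E -(near_eq_derive _ E) derive_cst.
Unshelve. all: by end_near. Qed.

Lemma derive1_trunc_gt a v x : a < x -> derive1 (trunc a v) x = derive1 v x.
Proof.
move=> xa; have E : \near x, v x = trunc a v x.
  by near=> y; rewrite /trunc max_r//; apply: ltW; near: y; exact: lt_nbhsr.
by rewrite !derive1E -(near_eq_derive _ E).
Unshelve. all: by end_near. Qed.

Lemma set_itvoo_split a Rad : 0 < a -> a < Rad ->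
  `]0, Rad[%classic = `]0, a[%classic `|` [set a] `|` `]a, Rad[%classic :> set R.
Proof.
move=> a0 aR; apply/seteqP; split => x /=; rewrite !in_itv /=.
  move=> /andP[x0 xR]; case: (ltgtP x a) => xa; [|by right|by left; right].
  by left; left; rewrite x0.
move=> [[/andP[-> /lt_trans->]//|->]|/andP[ax ->]]; first by rewrite a0.
by rewrite (lt_trans a0).
Qed.

Lemma measurable_derive1_trunc Rad a v : 0 < a -> a < Rad ->
  measurable_fun `]0, Rad[ (derive1 v) ->
  measurable_fun `]0, Rad[ (derive1 (trunc a v)).
Proof.
(* The derivative has no controlled value at the kink [a], so this point is split off. *)
move=> a0 aR mv; rewrite (set_itvoo_split a)//.
apply/measurable_funU => //; first exact: measurableU.
split; [apply/measurable_funU => //; split|].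
- have E : {in `]0, a[%classic, cst 0 =1 derive1 (trunc a v)}.
    by move=> x; rewrite inE /= in_itv /= => /andP[_ xa]; rewrite derive1_trunc_lt.
  exact: (eq_measurable_fun _ E (measurable_cst _)).
- exact: measurable_fun_set1.
- have E : {in `]a, Rad[%classic, derive1 v =1 derive1 (trunc a v)}.
    by move=> x; rewrite inE /= in_itv /= => /andP[ax _]; rewrite derive1_trunc_gt.
  apply: (eq_measurable_fun _ E); apply: measurable_funS mv => // x /=.
  by rewrite !in_itv /= => /andP[ax ->]; rewrite (lt_trans a0).
Qed.

Lemma Lpnp_derive1_trunc p s Rad a v : p != 0 -> 0 < a -> a < Rad ->
  measurable_fun `]0, Rad[ (derive1 v) ->
  Lpnp p s Rad (derive1 (trunc a v)) =
  (\int[mu]_(x in `]a, Rad[) (`|derive1 v x| `^ p * (omega s * x `^ s))%:E)%E.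
Proof.
move=> p0 a0 aR mv; rewrite /Lpnp /wint (ge0_integral_split _ 0 a Rad)//.
- rewrite [X in (X + _)%E]integral0_eq ?add0e; last first.
    move=> x; rewrite /= in_itv /= => /andP[_ xa].
    by rewrite derive1_trunc_lt// normr0 powR0// mul0r.
  apply: eq_integral => x; rewrite inE /= in_itv /= => /andP[ax _].
  by rewrite derive1_trunc_gt.
- apply/measurable_EFinP; apply: measurable_fun_normpow.
  exact: measurable_derive1_trunc.
- by move=> x _; rewrite lee_fin mulr_ge0 ?powR_ge0// mulr_ge0 ?powR_ge0 ?omega_ge0.
Qed.

Lemma trunc_Xdense p al th Rad v a : 0 < p -> 0 <= th -> 0 < a -> a < Rad ->
  Xdense p al th Rad v -> Xdense p al th Rad (trunc a v).
Proof.
move=> p0 th0 a0 aR [acv [v0 [[mv vfin] [mv' v'fin]]]].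
split; first exact: AC_loc_trunc.
split.
  apply: cvg_trans v0; apply: near_eq_cvg; near=> x.
  by rewrite /trunc max_r//; apply: ltW; near: x; exact: nbhs_left_gt.
have mt : measurable_fun `]0, Rad[ (trunc a v).
  apply: (measurable_comp (F := `]0, Rad[%classic)) => //.
  - move=> _ [x /= + <-]; rewrite !in_itv /= => /andP[x0 xR].
    by rewrite lt_max a0 gt_max aR.
  - exact: (measurable_maxr (measurable_cst a) (@measurable_id _ _ _)).
split; [split; [exact: mt|]|split; [exact: measurable_derive1_trunc|]].
(* On (0, a) the truncation is the constant [v a], and the weight there is at most its value at
   [Rad] because th >= 0. *)
- apply: (@le_lt_trans _ _ (Lpnp p th Rad v +
     \int[mu]_(x in `]0%R, Rad[) (`|v a| `^ p * (omega th * Rad `^ th))%:E)%E).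
    rewrite -ge0_integralD//=.
    + apply: ge0_le_integral => //.
      * by move=> x _; rewrite lee_fin mulr_ge0 ?powR_ge0// mulr_ge0 ?powR_ge0 ?omega_ge0.
      * by apply/measurable_EFinP; exact: measurable_fun_normpow.
      * apply: emeasurable_funD => //; apply/measurable_EFinP => //.
        exact: measurable_fun_normpow.
      * move=> x; rewrite /= in_itv /= => /andP[x0 xR]; rewrite -EFinD lee_fin.
        rewrite /trunc; case: (leP a x) => ax.
          by rewrite lerDl mulr_ge0 ?powR_ge0// mulr_ge0 ?powR_ge0 ?omega_ge0.
        rewrite -[leLHS]add0r lerD//.
          by rewrite mulr_ge0 ?powR_ge0// mulr_ge0 ?powR_ge0 ?omega_ge0.
        rewrite ler_wpM2l ?powR_ge0// ler_wpM2l ?omega_ge0//.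
        by apply: le_powR2 => //; exact: ltW.
    + by move=> x _; rewrite lee_fin mulr_ge0 ?powR_ge0// mulr_ge0 ?powR_ge0 ?omega_ge0.
    + by apply/measurable_EFinP; exact: measurable_fun_normpow.
    + by move=> x _; rewrite lee_fin mulr_ge0 ?powR_ge0// mulr_ge0 ?powR_ge0 ?omega_ge0.
  apply: lte_add_pinfty; first exact: vfin.
  by rewrite integral_oo_cst ?ltry// ltW// (lt_trans a0).
- rewrite Lpnp_derive1_trunc ?gt_eqF//; apply: le_lt_trans v'fin.
  apply: ge0_subset_integral => //.
  + by apply/measurable_EFinP; exact: measurable_fun_normpow.
  + by move=> x _; rewrite lee_fin mulr_ge0 ?powR_ge0// mulr_ge0 ?powR_ge0 ?omega_ge0.
  + by move=> x; rewrite /= !in_itv /= => /andP[ax ->]; rewrite (lt_trans a0).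
Unshelve. all: by end_near. Qed.

Lemma Xdense_Xspace p al th Rad v : p != 0 ->
  Xdense p al th Rad v -> Xspace p al th Rad v (derive1 v).
Proof.
move=> p0 Xv; have [_ [_ [[mv _] [mv' _]]]] := Xv.
have L0 s (f : R -> R) : Lpnp p s Rad (fun r => f r - f r) = 0%E.
  by apply: integral0_eq => x _; rewrite subrr normr0 powR0// mul0r.
do 2!split => //; exists (fun=> v); split => //.
by rewrite !L0; split; exact: cvg_cst.
Qed.

Lemma Xdense_lambda_le p al th Rad nu v : 0 < p -> 0 <= nu ->
  (nu%:E <= lambda_at p al th Rad)%E -> Xdense p al th Rad v ->
  (nu%:E * Lpnp p th Rad v <= Lpnp p al Rad (derive1 v))%E.
Proof.
move=> p0 nu0 nul Xv; have [_ [_ [Lv Lv']]] := Xv.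
have [->|v0] := eqVneq (Lpnp p th Rad v) 0%E; first by rewrite mule0 Lpnp_ge0.
have vfin := inLp_fin_num _ _ _ _ Lv.
have v'fin := inLp_fin_num _ _ _ _ Lv'.
have : (nu%:E <= (fine (Lpnp p al Rad (derive1 v)) / fine (Lpnp p th Rad v))%:E)%E.
  apply: le_trans nul _; apply: ereal_inf_lbound.
  by exists v, (derive1 v); split => //; apply: Xdense_Xspace; rewrite ?gt_eqF.
have fv0 : 0 < fine (Lpnp p th Rad v).
  apply: fine_gt0; apply/andP; split; last exact: Lv.2.
  by rewrite lt_neqAle eq_sym v0; exact: Lpnp_ge0.
by rewrite lee_fin ler_pdivlMr// -(fineK vfin) -(fineK v'fin) -EFinM lee_fin.
Qed.

End Truncation.

(** * Absorbing the zeroth-order term *)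

#[local] Opaque omega.

Section Coercive.
Variable R : realType.
Variables (p th Rad : R).
Hypotheses (p2 : 2 <= p) (R0 : 0 < Rad) (pth : p - 1 <= th).
Notation mu := (@lebesgue_measure R).
Notation oa := (@omega R (p - 1)).
Notation ot := (@omega R th).
Hypothesis oa0 : 0 < oa.
Implicit Types (v : R -> R) (a b x r nu : R).

Let p0 : 0 < p. Proof. by apply: lt_le_trans p2. Qed.
Let p1 : 1 < p. Proof. by apply: lt_le_trans p2; rewrite ltr1n. Qed.
Let p10 : 0 < p - 1. Proof. by rewrite subr_gt0. Qed.
Let p11 : 1 <= p - 1. Proof. by move: p2; lra. Qed.
Let p22 : p <= 2 * (p - 1). Proof. by move: p2; lra. Qed.
Let th10 : 0 <= th - (p - 1). Proof. by rewrite subr_ge0. Qed.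
Let th1 : 1 <= th. Proof. exact: le_trans pth. Qed.
Let th0 : 0 <= th. Proof. exact: le_trans th1. Qed.
Let ot0 : 0 <= ot. Proof. exact: omega_ge0. Qed.

(** The exponent is chosen to make rho^(-1/(p-1)) equal to 1 + b x, which, divided by x, integrates
    to a logarithm plus a linear term. *)
Definition rho b x : R := (1 + b * x) `^ (- (p - 1)).

Lemma rho_gt0 b x : 0 <= b -> 0 <= x -> 0 < rho b x.
Proof. by move=> b0 x0; rewrite powR_gt0// ltr_wpDr// mulr_ge0. Qed.

(** Because p - 1 >= 1. It yields 1 - rho >= b x / (1 + b x), the form used in both weight
    comparisons. *)
Lemma rho_le b x : 0 <= b -> 0 <= x -> rho b x <= (1 + b * x)^-1.
Proof.
move=> b0 x0; have h : 1 <= 1 + b * x by rewrite lerDl mulr_ge0.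
have h0 : 0 < 1 + b * x by exact: lt_le_trans h.
rewrite /rho powRN lef_pV2 ?posrE ?powR_gt0//.
by rewrite -[leLHS]powRr1 ?(ltW h0)// ler_powR.
Qed.

Lemma rho_le1 b x : 0 <= b -> 0 <= x -> rho b x <= 1.
Proof.
move=> b0 x0; apply: le_trans (rho_le _ _ b0 x0) _.
by rewrite invf_le1 ?lerDl ?mulr_ge0// ltr_wpDr// mulr_ge0.
Qed.

Lemma rho_powR b x : 0 <= b -> 0 <= x -> rho b x `^ (- (p - 1)^-1) = 1 + b * x.
Proof.
move=> b0 x0; rewrite /rho -powRrM mulrNN mulfV ?gt_eqF// powRr1//.
by rewrite addr_ge0// mulr_ge0.
Qed.

Lemma measurable_rho D b : measurable_fun D (rho b).
Proof.
apply: (measurableT_comp (measurable_powR _)).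
by apply: measurable_funD => //; apply: measurable_funM => //.
Qed.

Lemma measurable_energy b v : measurable_fun `]0, Rad[ (derive1 v) ->
  measurable_fun `]0, Rad[ (fun x =>
    (`|derive1 v x| `^ p * ((1 - rho b x) * (oa * x `^ (p - 1))))%:E).
Proof.
move=> mv; apply/measurable_EFinP; apply: measurable_funM.
  by apply: (measurableT_comp (measurable_powR p)); exact: measurableT_comp.
apply: measurable_funM.
  by apply: measurable_funB => //; exact: measurable_rho.
by apply: measurable_funM => //; exact: measurable_funS (measurable_powR _).
Qed.

Lemma normpow_ge0 (q s y x : R) : 0 <= `|y| `^ q * (@omega R s * x `^ s).
Proof. by apply: mulr_ge0; [exact: powR_ge0|apply: mulr_ge0; [exact: omega_ge0|exact: powR_ge0]]. Qed.

(** Hoelder's inequality on (x, a) with weight y^(2(p-1)), whose dual y^(-2) has integral at most 1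
    / x, bounds |v x - v a|^p by x^(1-p) times the integral of |v'|^p y^(2(p-1)). Then x^th absorbs
    x^(1-p), and y^(2(p-1)) <= y^p since y <= 1 and p >= 2. The integrand on the left is thus at
    most a constant, while the weight on the right has one power of x more than the energy. *)
Lemma hardy_trunc v a : 0 < a -> a < Rad -> a <= 1 -> Xdense p (p - 1) th Rad v ->
  (\int[mu]_(x in `]0%R, a[) (`|v x - v a| `^ p * (ot * x `^ th))%:E <=
   (ot * a)%:E * \int[mu]_(x in `]0%R, a[) (`|derive1 v x| `^ p * x `^ p)%:E)%E.
Proof.
move=> a0 aR a1 [acv [_ [[mv _] [mv' v'fin]]]].
have sub : (`]0, a[%classic : set R) `<=` `]0, Rad[%classic.
  by move=> x /=; rewrite !in_itv /= => /andP[-> /lt_trans->].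
have mva : measurable_fun `]0, a[ v by exact: measurable_funS mv.
have mv'a : measurable_fun `]0, a[ (derive1 v) by exact: measurable_funS mv'.
have mI q : measurable_fun `]0, a[ (fun x => (`|derive1 v x| `^ p * x `^ q)%:E).
  apply/measurable_EFinP; apply: measurable_funM.
    by apply: (measurableT_comp (measurable_powR p)); exact: measurableT_comp.
  exact: measurable_funS (measurable_powR _).
set I := (\int[mu]_(x in _) (`|derive1 v x| `^ p * x `^ p)%:E)%E.
have I0 : (0 <= I)%E by apply: integral_ge0 => x _; rewrite lee_fin mulr_ge0 ?powR_ge0.
(* Since x^p <= x^(p-1) on (0, 1], the energy of [v] dominates [I], which can then serve as a real
   constant in Hoelder's inequality. *)
have Ifin : I \is a fin_num.
  rewrite ge0_fin_numE//.
  apply: (@le_lt_trans _ _ ((oa^-1)%:E * Lpnp p (p - 1) Rad (derive1 v))%E); last first.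
    by rewrite -(fineK (inLp_fin_num _ _ _ _ _ (conj mv' v'fin))) -EFinM ltry.
  rewrite /Lpnp /wint -ge0_integralZl//=.
  - apply: (@le_trans _ _ (\int[mu]_(x in `]0%R, a[) (oa^-1 *
         (`|derive1 v x| `^ p * (oa * x `^ (p - 1))))%:E)%E).
      apply: ge0_le_integral => //.
      + by move=> x _; rewrite lee_fin mulr_ge0 ?powR_ge0.
      + exact: mI.
      + apply/measurable_EFinP; apply: measurable_funM => //.
        exact: measurable_fun_normpow.
      + move=> x; rewrite /= in_itv /= => /andP[x0 xa].
        rewrite lee_fin mulrCA ler_wpM2l ?powR_ge0// mulrA mulVf ?mul1r ?gt_eqF//.
        by rewrite ger_powR ?x0 ?(le_trans (ltW xa))// gerBl.
    apply: ge0_subset_integral => //.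
    + apply/measurable_EFinP; apply: measurable_funM => //.
      exact: measurable_fun_normpow.
    + by move=> x _; rewrite lee_fin; apply: mulr_ge0; [rewrite invr_ge0 ltW|exact: normpow_ge0].
  - by apply/measurable_EFinP; exact: measurable_fun_normpow.
  - by move=> x _; rewrite lee_fin; exact: normpow_ge0.
  - by rewrite lee_fin invr_ge0 omega_ge0.
have IE : I = (fine I)%:E by rewrite fineK.
have fI0 : 0 <= fine I by exact: fine_ge0.
have pt x : 0 < x -> x < a -> `|v x - v a| `^ p * (ot * x `^ th) <= ot * fine I.
  move=> x0 xa.
  have acx : abs_cont_on x a v by exact: acv.
  have subx : (`]x, a[%classic : set R) `<=` `]0, a[%classic.
    by move=> y /=; rewrite !in_itv /= => /andP[/(lt_trans x0)-> ->].
  have mk : measurable_fun `]x, a[ (fun y : R => y `^ (2 * (p - 1))).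
    exact: measurable_funS (measurable_powR _).
  have mvx : measurable_fun `]x, a[ (derive1 v) by exact: measurable_funS mv'a.
  have k0 y : x < y < a -> 0 < y `^ (2 * (p - 1)).
    by move=> /andP[xy _]; rewrite powR_gt0// (lt_trans x0).
  have x10 : 0 <= x^-1 by rewrite invr_ge0 ltW.
  have hA : (\int[mu]_(y in `]x, a[) (`|derive1 v y| `^ p * y `^ (2 * (p - 1)))%:E <= (fine I)%:E)%E.
    rewrite -IE /I; apply: (@le_trans _ _ (\int[mu]_(y in `]x, a[) (`|derive1 v y| `^ p * y `^ p)%:E)%E).
      apply: ge0_le_integral => //.
      - by move=> y _; rewrite lee_fin mulr_ge0 ?powR_ge0.
      - exact: measurable_funS (mI _).
      - exact: measurable_funS (mI _).
      - move=> y; rewrite /= in_itv /= => /andP[xy ya].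
        rewrite lee_fin ler_wpM2l ?powR_ge0// ger_powR//.
        by rewrite (lt_trans x0 xy) (le_trans (ltW ya)).
    apply: ge0_subset_integral => //; first exact: mI.
    by move=> y _; rewrite lee_fin mulr_ge0 ?powR_ge0.
  have hB : (\int[mu]_(y in `]x, a[) ((y `^ (2 * (p - 1))) `^ (- (p - 1)^-1))%:E <= (x^-1)%:E)%E.
    apply: le_trans (integral_invXn2_le R x a x0 (ltW xa)).
    rewrite le_eqVlt; apply/orP; left; apply/eqP; apply: eq_integral => y _.
    by rewrite -powRrM mulrN mulfK ?gt_eqF.
  have H := abs_cont_hoelder R v _ p x a (fine I) x^-1 p1 xa acx mvx mk k0 fI0 x10 hA hB.
  have {}H : `|v x - v a| `^ p <= fine I * (x^-1) `^ (p - 1).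
    rewrite distrC; apply: le_trans (le_powR2 _ _ _ _ (ltW p0) (normr_ge0 _) H) _.
    rewrite powRM ?powR_ge0// powRK ?gt_eqF// -powRrM mulrBl mul1r mulVf ?gt_eqF//.
  rewrite mulrCA ler_wpM2l ?omega_ge0//.
  apply: le_trans (ler_wpM2r (powR_ge0 _ _) H) _.
  rewrite -mulrA ler_piMr// -powR_inv1 ?(ltW x0)// -powRrM mulN1r -powRD; last first.
    by apply/implyP => _; rewrite gt_eqF.
  rewrite -[leRHS](powRr0 x) ger_powR//; last by rewrite addrC.
  by rewrite x0 (le_trans (ltW xa)).
rewrite IE -EFinM; apply: le_trans (_ : (\int[mu]_(x in `]0%R, a[) (ot * fine I)%:E <= _)%E).
  apply: ge0_le_integral => //.
  - by move=> x _; rewrite lee_fin; exact: normpow_ge0.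
  - apply/measurable_EFinP; apply: measurable_fun_normpow.
    exact: measurable_funB.
  - by move=> x; rewrite /= in_itv /= lee_fin => /andP[]; exact: pt.
by rewrite integral_oo_cst ?(ltW a0)// lee_fin; rewrite subr0 mulrAC.
Qed.

(** The room between [nu] and lambda will pay for the factor 1 + kap; lambda may be infinite, whence
    a real [nu1]. *)
Lemma ereal_lt_between nu (l : \bar R) : 0 <= nu -> (nu%:E < l)%E ->
  exists2 nu1, nu < nu1 & (nu1%:E <= l)%E.
Proof.
move=> nu0; case: l => [l| |] //.
- rewrite lte_fin => nul; exists ((nu + l) / 2); rewrite ?lee_fin; lra.
- by move=> _; exists (nu + 1); rewrite ?leey// ltrDl.
Qed.

(** On (0, a) one has 1 + b x <= 2 b a, so 1 - rho >= x / (2 a): this supplies the extra factor x of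
    the Hardy weight. *)
Lemma weight_near0 (a b c o x y : R) : 0 < x -> x < a -> 1 <= b * a ->
  0 <= c -> 2 * a * c <= o -> 0 <= y ->
  c * (y * x `^ p) <= y * ((1 - rho b x) * (o * x `^ (p - 1))).
Proof.
move=> x0 xa ba c0 co y0; have x0' := ltW x0.
have a0 : 0 < a by exact: lt_trans xa.
have b0 : 0 < b by rewrite -(pmulr_lgt0 _ a0); exact: lt_le_trans ba.
have xp : x `^ p = x * x `^ (p - 1).
  rewrite -[X in X * _]powRr1// -powRD; first by congr (_ `^ _); ring.
  by apply/implyP => _; rewrite gt_eqF.
rewrite mulrCA xp ler_wpM2l// !mulrA ler_wpM2r ?powR_ge0//.
have bx : b * x <= b * a by rewrite ler_wpM2l// ltW.
have bx0 : 0 <= b * x by rewrite mulr_ge0// ltW.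
have h : x <= (1 - rho b x) * (2 * a).
  apply: (@le_trans _ _ ((1 - (1 + b * x)^-1) * (2 * a))); last first.
    by rewrite ler_wpM2r ?mulr_ge0 ?(ltW a0)// lerD2l lerN2 rho_le// ltW.
  have -> : 1 - (1 + b * x)^-1 = b * x / (1 + b * x).
    by field; rewrite gt_eqF// ltr_wpDr.
  rewrite mulrAC ler_pdivlMr ?ltr_wpDr//.
  have -> : b * x * (2 * a) = x * (2 * (b * a)) by ring.
  by rewrite ler_wpM2l//; lra.
apply: (@le_trans _ _ (c * ((1 - rho b x) * (2 * a)))); first by rewrite ler_wpM2l.
have -> : c * ((1 - rho b x) * (2 * a)) = (1 - rho b x) * (2 * a * c) by ring.
by rewrite ler_wpM2l// subr_ge0 rho_le1// ltW.
Qed.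

(** The condition on [eta] reads eta <= b a / (1 + b a), and y / (1 + y) increases with y = b x. *)
Lemma weight_away (a b eta x y z : R) : 0 < a -> 0 <= b -> a < x ->
  eta <= (1 - eta) * (b * a) -> eta < 1 -> 0 <= y -> 0 <= z ->
  eta * (y * z) <= y * ((1 - rho b x) * z).
Proof.
move=> a0 b0 ax bae eta1 y0 z0.
rewrite mulrCA ler_wpM2l// ler_wpM2r//.
have x0 : 0 <= x by rewrite ltW// (lt_trans a0).
have bx0 : 0 < 1 + b * x by rewrite ltr_wpDr// mulr_ge0.
apply: (@le_trans _ _ (1 - (1 + b * x)^-1)); last by rewrite lerD2l lerN2 rho_le.
have : (1 - eta) * (b * a) <= (1 - eta) * (b * x).
  by rewrite ler_wpM2l ?subr_ge0 ?(ltW eta1)// ler_wpM2l// ltW.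
have -> : 1 - (1 + b * x)^-1 = b * x / (1 + b * x) by field; rewrite gt_eqF.
by rewrite ler_pdivlMr// => /(le_trans bae); rewrite mulrDr mulr1 mulrBl mul1r; lra.
Qed.

Lemma energy_near0 (a b c : R) (h : R -> R) : 0 < a -> 1 <= b * a ->
  measurable_fun `]0, a[ h -> 0 <= c -> 2 * a * c <= oa ->
  (c%:E * \int[mu]_(x in `]0%R, a[) (`|h x| `^ p * x `^ p)%:E <=
   \int[mu]_(x in `]0%R, a[)
     (`|h x| `^ p * ((1 - rho b x) * (oa * x `^ (p - 1))))%:E)%E.
Proof.
move=> a0 ba mh c0 ca.
have mhp : measurable_fun `]0, a[ (fun x => `|h x| `^ p).
  by apply: (measurableT_comp (measurable_powR p)); exact: measurableT_comp.
have mpow q : measurable_fun `]0, a[ (fun x : R => x `^ q).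
  exact: measurable_funS (measurable_powR _).
have mhx : measurable_fun `]0, a[ (fun x => `|h x| `^ p * x `^ p).
  exact: measurable_funM.
have hx0 x : 0 <= `|h x| `^ p * x `^ p by rewrite mulr_ge0 ?powR_ge0.
rewrite -ge0_integralZl//=; last 2 first.
- exact/measurable_EFinP.
- by move=> x _; rewrite lee_fin.
apply: ge0_le_integral => //=.
- by move=> x _; rewrite lee_fin mulr_ge0.
- by apply/measurable_EFinP; apply: measurable_funM.
- apply/measurable_EFinP; apply: measurable_funM => //; apply: measurable_funM.
    by apply: measurable_funB => //; exact: measurable_rho.
  by apply: measurable_funM => //; exact: mpow.
- move=> x; rewrite in_itv /= => /andP[x0 xa]; rewrite lee_fin.
  by apply: weight_near0 x0 xa ba c0 ca _; exact: powR_ge0.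
Qed.

Lemma energy_away (a b eta D : R) (h : R -> R) : 0 < a -> 0 <= b ->
  eta <= (1 - eta) * (b * a) -> 0 <= eta -> eta < 1 ->
  measurable_fun `]a, D[ h ->
  (eta%:E * \int[mu]_(x in `]a, D[) (`|h x| `^ p * (oa * x `^ (p - 1)))%:E <=
   \int[mu]_(x in `]a, D[)
     (`|h x| `^ p * ((1 - rho b x) * (oa * x `^ (p - 1))))%:E)%E.
Proof.
move=> a0 b0 bae eta0 eta1 mh.
have mhw : measurable_fun `]a, D[ (fun x => `|h x| `^ p * (oa * x `^ (p - 1))).
  exact: measurable_fun_normpow.
rewrite -ge0_integralZl//=; last 2 first.
- exact/measurable_EFinP.
- by move=> x _; rewrite lee_fin; exact: normpow_ge0.
apply: ge0_le_integral => //=.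
- by move=> x _; rewrite lee_fin; apply: mulr_ge0 => //; exact: normpow_ge0.
- by apply/measurable_EFinP; exact: measurable_funM.
- apply/measurable_EFinP; apply: measurable_funM.
    by apply: (measurableT_comp (measurable_powR p)); exact: measurableT_comp.
  apply: measurable_funM.
    by apply: measurable_funB => //; exact: measurable_rho.
  by apply: measurable_funM => //; exact: measurable_funS (measurable_powR _).
- move=> x; rewrite in_itv /= => /andP[ax _]; rewrite lee_fin.
  apply: weight_away a0 b0 ax bae eta1 _ _; first exact: powR_ge0.
  by apply: mulr_ge0; [exact: ltW|exact: powR_ge0].
Qed.

Lemma Lpnp_le_split s (D : R) (f g : R -> R) (kap C : R) : 0 <= kap -> 0 <= C ->
  (forall x y, 0 <= x -> 0 <= y ->
    (x + y) `^ p <= (1 + kap) * x `^ p + C * y `^ p) ->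
  measurable_fun `]0, D[ f -> measurable_fun `]0, D[ g ->
  (Lpnp p s D f <=
    (1 + kap)%:E * Lpnp p s D g + C%:E * Lpnp p s D (fun r => (f r - g r)%R))%E.
Proof.
move=> kap0 C0 HC mf mg.
have k10 : 0 <= 1 + kap by rewrite addr_ge0.
have mfg : measurable_fun `]0, D[ (fun r => f r - g r) by exact: measurable_funB.
have mw (h : R -> R) : measurable_fun `]0, D[ h ->
    measurable_fun `]0, D[ (fun x => (`|h x| `^ p * (@omega R s * x `^ s))%:E).
  by move=> mh; apply/measurable_EFinP; exact: measurable_fun_normpow.
have mc (c : R) (h : R -> R) : measurable_fun `]0, D[ h -> measurable_fun `]0, D[
    (fun x => (c * (`|h x| `^ p * (@omega R s * x `^ s)))%:E).
  move=> mh; apply/measurable_EFinP; apply: measurable_funM => //.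
  exact: measurable_fun_normpow.
have nc (c : R) (h : R -> R) x : 0 <= c ->
    (0 <= (c * (`|h x| `^ p * (@omega R s * x `^ s)))%:E)%E.
  by move=> c0; rewrite lee_fin; apply: mulr_ge0 => //; exact: normpow_ge0.
rewrite /Lpnp /wint -ge0_integralZl//=; last 2 first.
- exact: mw.
- by move=> x _; rewrite lee_fin; exact: normpow_ge0.
rewrite -ge0_integralZl//=; last 2 first.
- exact: mw.
- by move=> x _; rewrite lee_fin; exact: normpow_ge0.
rewrite -ge0_integralD//=; last 4 first.
- by move=> x _; apply: (nc _ g).
- exact: (mc _ g).
- by move=> x _; apply: (nc _ (fun r => f r - g r)).
- exact: (mc _ (fun r => f r - g r)).
apply: ge0_le_integral => //=.
- by move=> x _; rewrite lee_fin; exact: normpow_ge0.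
- exact: mw.
- by apply: emeasurable_funD; [exact: (mc _ g)|exact: (mc _ (fun r => f r - g r))].
- move=> x _; rewrite -EFinD lee_fin.
  have : 0 <= @omega R s * x `^ s by apply: mulr_ge0; [exact: omega_ge0|exact: powR_ge0].
  move: (@omega R s * x `^ s) => w w0.
  rewrite [X in _ <= X + _]mulrA [X in _ <= _ + X]mulrA -mulrDl ler_wpM2r//.
  apply: le_trans (HC _ _ (normr_ge0 _) (normr_ge0 _)).
  apply: le_powR2; rewrite ?(ltW p0)// -[X in `|X|](subrK (g x)) addrC.
  exact: ler_normD.
Qed.

Lemma energy_ge0 (b x y : R) : 0 <= b -> 0 <= x ->
  0 <= `|y| `^ p * ((1 - rho b x) * (oa * x `^ (p - 1))).
Proof.
move=> b0 x0; apply: mulr_ge0; first exact: powR_ge0.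
apply: mulr_ge0; first by rewrite subr_ge0 rho_le1.
by apply: mulr_ge0; [exact: ltW|exact: powR_ge0].
Qed.

(** In the application [L], [LV], [LW] are the p-th powers of the norms of v, of its truncation and
    of their difference, [T] is the energy beyond [a], [I] the Hardy integral, and [E1], [E2] are
    the energies weighted by 1 - rho on (0, a) and beyond. *)
Lemma coercive_arith (nu nu1 kap C c : R) (L LV LW T I E1 E2 : \bar R) :
  0 <= nu -> 0 < nu1 -> 0 <= kap -> 0 <= C -> (0 <= LV)%E -> (0 <= LW)%E ->
  (nu1%:E * LV <= T)%E -> (LW <= c%:E * I)%E ->
  (L <= (1 + kap)%:E * LV + C%:E * LW)%E ->
  ((nu * C * c)%:E * I <= E1)%E -> ((nu * (1 + kap) / nu1)%:E * T <= E2)%E ->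
  (nu%:E * L <= E2 + E1)%E.
Proof.
move=> nu0 nu10 kap0 C0 LV0 LW0 VT WI LL h1 h2.
have k10 : 0 <= 1 + kap by rewrite addr_ge0.
apply: le_trans (lee_wpmul2l _ LL) _; first by rewrite lee_fin.
rewrite ge0_muleDr; [|by apply: mule_ge0; rewrite ?lee_fin..].
apply: leeD.
  apply: le_trans h2; rewrite muleA -EFinM [(_ / nu1)%:E]EFinM -muleA.
  apply: lee_wpmul2l; first by rewrite lee_fin mulr_ge0.
  rewrite -(@lee_pmul2l _ nu1%:E) ?lte_fin// muleA -EFinM mulfV ?gt_eqF// mul1e.
  exact: VT.
apply: le_trans h1.
have -> : (nu%:E * (C%:E * LW) = (nu * C)%:E * LW)%E by rewrite muleA -EFinM.
have -> : ((nu * C * c)%:E * I = (nu * C)%:E * (c%:E * I))%E by rewrite muleA -EFinM.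
by apply: lee_wpmul2l => //; rewrite lee_fin mulr_ge0.
Qed.

(* The constants: [kap] keeps [eta = nu (1 + kap) / nu1 < 1]; [a] is so small
   that the Hardy term on (0, a) costs less than a multiple of [x]; [b] is so
   large that [1 - rho b] dominates [x / (2 a)] on (0, a) and [eta] beyond. *)
Lemma coercive_weight nu : 0 <= nu -> (nu%:E < lambda_at p (p - 1) th Rad)%E ->
  exists2 b, 0 < b & forall v, Xdense p (p - 1) th Rad v ->
  (nu%:E * Lpnp p th Rad v <= \int[mu]_(x in `]0%R, Rad[)
     (`|derive1 v x| `^ p * ((1 - rho b x) * (oa * x `^ (p - 1))))%:E)%E.
Proof.
move=> nu0 /(ereal_lt_between _ _ nu0)[nu1 nunu1 nu1l].
have nu10 : 0 < nu1 by exact: le_lt_trans nunu1.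
(* This makes nu kap less than half of nu1 - nu; the summand 1 covers nu = 0. *)
pose kap := (nu1 - nu) / (2 * (nu + 1)).
have kap0 : 0 < kap by rewrite divr_gt0 ?subr_gt0// mulr_gt0// ltr_wpDl.
have [C C0 HC] := powRD_le R p kap p0 kap0.
pose eta := nu * (1 + kap) / nu1.
have eta0 : 0 <= eta by rewrite divr_ge0 ?(ltW nu10)// mulr_ge0// addr_ge0// ltW.
have eta1 : eta < 1.
  rewrite ltr_pdivrMr// mul1r mulrDr mulr1.
  have : nu * kap < nu1 - nu.
    rewrite /kap mulrA ltr_pdivrMr ?mulr_gt0 ?ltr_wpDl// mulrC.
    by rewrite ltr_pM2l ?subr_gt0//; move: nu0; lra.
  by move: nunu1; lra.
(* [energy_near0] will be used with c = nu C ot a and asks for 2 a c <= oa; as a^2 <= a, it is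
   enough that M a <= oa. The summand 1 keeps [M] positive. *)
pose M := 2 * nu * C * ot + 1.
have nCo0 : 0 <= nu * C * ot by do 2 (apply: mulr_ge0 => //).
have M0 : 0 < M.
  by rewrite /M -!(mulrA 2); apply: ltr_wpDl => //; apply: mulr_ge0.
pose a := Num.min (Rad / 2) (Num.min 1 (oa / M)).
have a0 : 0 < a.
  rewrite /a lt_min; apply/andP; split; first exact: divr_gt0.
  by rewrite lt_min; apply/andP; split; [exact: ltr01|exact: divr_gt0].
have aR : a < Rad by rewrite gt_min; apply/orP; left; rewrite ltr_pdivrMr// ltr_pMr// ltr1n.
have a1 : a <= 1 by rewrite !ge_min lexx orbT.
have aM : M * a <= oa by rewrite mulrC -ler_pdivlMr// !ge_min lexx !orbT.
clearbody a; pose b := Num.max a^-1 (eta / ((1 - eta) * a)).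
have b0 : 0 < b by rewrite lt_max invr_gt0 a0.
have ba1 : 1 <= b * a by rewrite -ler_pdivrMr// mul1r le_max lexx.
have bae : eta <= (1 - eta) * (b * a).
  have : eta / ((1 - eta) * a) <= b by rewrite le_max lexx orbT.
  by rewrite ler_pdivrMr ?mulr_gt0 ?subr_gt0// mulrCA.
clearbody b; exists b => // v Xv; have [acv [_ [[mv vfin] [mv' v'fin]]]] := Xv.
have XV := trunc_Xdense _ p _ th Rad v a p0 th0 a0 aR Xv.
have [_ [_ [[mV Vfin] _]]] := XV.
set V := trunc R a v in XV mV Vfin *.
pose T := (\int[mu]_(x in `]a, Rad[) (`|derive1 v x| `^ p * (oa * x `^ (p - 1)))%:E)%E.
have VT : (nu1%:E * Lpnp p th Rad V <= T)%E.
  rewrite /T -(Lpnp_derive1_trunc R p (p - 1) Rad a v) ?gt_eqF//.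
  exact: (Xdense_lambda_le R p (p - 1) th Rad nu1 _ p0 (ltW nu10) nu1l XV).
pose I := (\int[mu]_(x in `]0%R, a[) (`|derive1 v x| `^ p * x `^ p)%:E)%E.
have HI := hardy_trunc v a a0 aR a1 Xv.
have mw (f : R -> R) : measurable_fun `]0, Rad[ f ->
    measurable_fun `]0, Rad[ (fun x => (`|f x| `^ p * (ot * x `^ th))%:E).
  by move=> mf; apply/measurable_EFinP; exact: measurable_fun_normpow.
have mvV : measurable_fun `]0, Rad[ (fun r => v r - V r) by exact: measurable_funB.
have dV : Lpnp p th Rad (fun r => v r - V r) =
    (\int[mu]_(x in `]0%R, a[) (`|v x - v a| `^ p * (ot * x `^ th))%:E)%E.
  rewrite /Lpnp /wint (ge0_integral_split _ 0 a Rad)//.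
  - rewrite [X in (_ + X)%E]integral0_eq ?adde0; last first.
      move=> x; rewrite /= in_itv /= => /andP[ax _].
      by rewrite /V /trunc max_r ?(ltW ax)// subrr normr0 powR0 ?mul0r// gt_eqF.
    apply: eq_integral => x; rewrite inE /= in_itv /= => /andP[_ xa].
    by rewrite /V /trunc max_l// ltW.
  - exact: mw.
  - by move=> x _; rewrite lee_fin; exact: normpow_ge0.
have step1 := Lpnp_le_split th Rad v V kap C (ltW kap0) C0 HC mv mV.
pose E := fun x => (`|derive1 v x| `^ p * ((1 - rho b x) * (oa * x `^ (p - 1))))%:E.
have mE : measurable_fun `]0, Rad[ E by exact: measurable_energy.
have b0' : 0 <= b by exact: ltW.
have E0 x : 0 < x < Rad -> (0 <= E x)%E.
  by move=> /andP[x0 _]; rewrite lee_fin; apply: energy_ge0; [exact: b0'|exact: ltW].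
have sub0 : (`]0, a[%classic : set R) `<=` `]0, Rad[%classic.
  by move=> x /=; rewrite !in_itv /= => /andP[-> /lt_trans->].
have subR : (`]a, Rad[%classic : set R) `<=` `]0, Rad[%classic.
  by move=> x /=; rewrite !in_itv /= => /andP[/(lt_trans a0)-> ->].
have T0 : (0 <= T)%E by apply: integral_ge0 => x _; rewrite lee_fin; exact: normpow_ge0.
have EI : ((nu * C * (ot * a))%:E * I <= \int[mu]_(x in `]0%R, a[) E x)%E.
  apply: (energy_near0 a b _ (derive1 v) a0 ba1).
  - exact: measurable_funS mv'.
  - by rewrite mulrA; apply: mulr_ge0; [exact: nCo0|exact: ltW].
  - have aa1 : a * a <= a by rewrite ler_piMr; [|exact: ltW|exact: a1].
    have := ler_wpM2l nCo0 aa1; move: aM; rewrite /M; set n := nu * C * ot.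
    have -> : nu * C * (ot * a) = n * a by rewrite /n; ring.
    have -> : 2 * nu * C * ot = 2 * n by rewrite /n; ring.
    by move: a0; lra.
have ET : (eta%:E * T <= \int[mu]_(x in `]a, Rad[) E x)%E.
  apply: (energy_away a b eta Rad (derive1 v) a0 b0' bae eta0 eta1).
  exact: measurable_funS mv'.
rewrite -/E (ge0_integral_split _ 0 a Rad _ a0 aR mE E0) addeC.
apply: (coercive_arith nu nu1 kap C (ot * a) _ _ _ _ _ _ _ nu0 nu10 (ltW kap0) C0 _ _ VT _ step1 EI ET).
- exact: Lpnp_ge0.
- exact: Lpnp_ge0.
- by rewrite dV; exact: HI.
Qed.

End Coercive.

(** * Moser's estimate *)

Section Tau.
Variable R : realType.
Variables th Rad b : R.
Hypotheses (th10 : 0 < th + 1) (b0 : 0 < b).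
Implicit Types r s : R.

(* Moser's variable [(th + 1) ln (Rad / r)], corrected so that its differential
   is proportional to [rho ^ (- 1 / (p - 1)) dr / r]. *)
Definition tau r : R := (th + 1) * (ln Rad - ln r + b * (Rad - r)).

Lemma tauB r s : tau r - tau s = (th + 1) * (ln s - ln r + b * (s - r)).
Proof. by rewrite /tau; ring. Qed.

Lemma tau_le r s : 0 < r -> r <= s -> tau s <= tau r.
Proof.
move=> r0 rs; rewrite -subr_ge0 tauB mulr_ge0 ?(ltW th10)//.
by rewrite addr_ge0 ?mulr_ge0 ?subr_ge0 ?(ltW b0)// ler_ln// posrE// (lt_le_trans r0).
Qed.

Lemma tau_Rad : tau Rad = 0.
Proof. by rewrite /tau !subrr mulr0 addr0 mulr0. Qed.

Lemma tau_ge0 r : 0 < r -> r <= Rad -> 0 <= tau r.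
Proof. by move=> r0 rR; rewrite -tau_Rad tau_le. Qed.

End Tau.

Section Moser.
Variable R : realType.
Variables (p th Rad b : R).
Hypotheses (p2 : 2 <= p) (R0 : 0 < Rad) (pth : p - 1 <= th) (b0 : 0 < b).
Notation lam := (@lebesgue_measure R).
Notation oa := (@omega R (p - 1)).
Notation ot := (@omega R th).
Notation m := (@mu R (p - 1) th).
Notation q := (p / (p - 1)).
Hypothesis oa0 : 0 < oa.
Implicit Types (v : R -> R) (r s x y : R).

Let p0 : 0 < p. Proof. by apply: lt_le_trans p2. Qed.
Let p1 : 1 < p. Proof. by apply: lt_le_trans p2; rewrite ltr1n. Qed.
Let p10 : 0 < p - 1. Proof. by rewrite subr_gt0. Qed.
Let th0 : 0 < th. Proof. exact: lt_le_trans pth. Qed.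
Let th10 : 0 < th + 1. Proof. exact: addr_gt0. Qed.
Let q0 : 0 < q. Proof. by rewrite divr_gt0. Qed.
Let qN : q^-1 = 1 - p^-1. Proof. exact: conj_exp_div. Qed.
Let m0 : 0 < m. Proof. by rewrite /mu mulr_gt0// powR_gt0. Qed.

Notation tau := (@tau R th Rad b).
Let tau_le := @tau_le R th Rad b th10 b0.
Let tau_ge0 := @tau_ge0 R th Rad b th10 b0.

(** * Points where Moser's pointwise bound is nearly attained *)

Section Cluster.
Variables (mm k : R) (v : R -> R) (energy_in : R -> R -> R).
Hypotheses (mm0 : 0 < mm) (k0 : 0 < k).
Hypothesis energy_in_ge0 : forall r s, 0 < r -> r < s -> s <= Rad -> 0 <= energy_in r s.
Hypothesis energy_in_le : forall r s, 0 < r -> r < s -> s <= Rad -> energy_in r s <= k.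
Hypothesis energy_inD : forall r s t, 0 < r -> r < s -> s < t -> t <= Rad ->
  energy_in r t = energy_in r s + energy_in s t.
Hypothesis tau_holder : forall r s, 0 < r -> r < s -> s < Rad ->
  `|v s - v r| <= energy_in r s `^ p^-1 * (mm^-1 * (tau r - tau s)) `^ q^-1.
Hypothesis v_vanish : forall r e, r < Rad -> 0 < e ->
  exists y, [/\ r < y, y < Rad & `|v y| < e].

Let pV0 : 0 <= p^-1. Proof. by rewrite invr_ge0 ltW. Qed.
Let qV0 : 0 <= q^-1. Proof. by rewrite invr_ge0 ltW. Qed.
Let mV0 : 0 <= mm^-1. Proof. by rewrite invr_ge0 ltW. Qed.

(** The limit s -> Rad of [tau_holder], through points [y] where |v y| < e; both factors on the
    right only grow when [y] is replaced by [Rad]. *)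
Lemma holder_at_Rad r : 0 < r -> r < Rad ->
  `|v r| <= energy_in r Rad `^ p^-1 * (mm^-1 * tau r) `^ q^-1.
Proof.
move=> r0 rR; apply/ler_addgt0Pl => e e0.
have [y [ry yR ye]] := v_vanish _ _ rR e0.
have y0 : 0 < y by exact: lt_trans ry.
apply: le_trans (_ : `|v y| + `|v y - v r| <= _).
  by rewrite -[X in `|X|](subKr (v y)); exact: ler_normB.
apply: lerD; first exact: ltW.
apply: le_trans (tau_holder _ _ r0 ry yR) _.
apply: ler_pM; [exact: powR_ge0|exact: powR_ge0| |].
  apply: le_powR2 => //; first by apply: energy_in_ge0 => //; exact: ltW.
  by rewrite (energy_inD r y Rad)// lerDl energy_in_ge0.
apply: le_powR2 => //.
  by apply: mulr_ge0 => //; rewrite subr_ge0 tau_le// ltW.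
by rewrite ler_wpM2l// gerBl tau_ge0// ltW.
Qed.

(** The normalization that turns [tau_holder] into the setting of [moser_pair]: energies become
    shares of [k], with sum at most 1, and [mm] disappears. Its q-th power is the exponent of the
    integrand. *)
Definition wscale r : R := mm `^ q^-1 * k `^ (- p^-1) * `|v r|.
Definition defect r : R := tau r - wscale r `^ q.

Lemma wscale_ge0 r : 0 <= wscale r.
Proof. by rewrite /wscale mulr_ge0// mulr_ge0 ?powR_ge0. Qed.

Lemma wscale_powR r : wscale r `^ q = mm * `|v r| `^ q * k `^ (- (p - 1)^-1).
Proof.
have pq : - p^-1 * q = - (p - 1)^-1 by field; rewrite !gt_eqF.
rewrite /wscale powRM ?mulr_ge0 ?powR_ge0// powRM ?powR_ge0//.
by rewrite powRK ?(ltW mm0) ?gt_eqF// -(powRrM k) pq mulrAC.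
Qed.

Let scale e D : 0 <= e -> 0 <= D ->
  mm `^ q^-1 * k `^ (- p^-1) * (e `^ p^-1 * (mm^-1 * D) `^ q^-1) =
  (e / k) `^ p^-1 * D `^ q^-1.
Proof.
move=> e0 D0; rewrite (powRM _ mV0 D0) (powRM _ e0); last by rewrite invr_ge0 ltW.
have -> : k^-1 `^ p^-1 = k `^ (- p^-1).
  by rewrite -powR_inv1 ?(ltW k0)// -powRrM mulN1r.
have H : mm `^ q^-1 * mm^-1 `^ q^-1 = 1.
  by rewrite -powRM ?(ltW mm0)// mulfV ?gt_eqF// one_powR.
move: H; set A := mm `^ _; set A' := mm^-1 `^ _; set B := k `^ _; set E := e `^ _.
set F := D `^ _ => H.
by rewrite -[RHS]mul1r -H -!mulrA; congr (_ * _); rewrite mulrCA mulrA mulrCA -!mulrA [A' * _]mulrCA.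
Qed.

Lemma wscale_le r : 0 < r -> r < Rad ->
  wscale r <= (energy_in r Rad / k) `^ p^-1 * tau r `^ q^-1.
Proof.
move=> r0 rR; rewrite -scale; [|exact: energy_in_ge0|by apply: tau_ge0 => //; exact: ltW].
by rewrite /wscale ler_wpM2l ?holder_at_Rad// mulr_ge0 ?powR_ge0.
Qed.

Lemma wscale_leD r s : 0 < r -> r < s -> s < Rad ->
  wscale r <= wscale s + (energy_in r s / k) `^ p^-1 * (tau r - tau s) `^ q^-1.
Proof.
move=> r0 rs sR; rewrite -scale; last 2 first.
- by apply: energy_in_ge0 => //; exact: ltW.
- by rewrite subr_ge0 tau_le// ltW.
rewrite /wscale -mulrDr ler_wpM2l ?mulr_ge0 ?powR_ge0//.
apply: le_trans (_ : `|v s| + `|v s - v r| <= _).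
  by rewrite -[X in `|X|](subKr (v s)); exact: ler_normB.
by rewrite lerD2l tau_holder.
Qed.

Lemma defect_ge0 r : 0 < r -> r < Rad -> 0 <= defect r.
Proof.
move=> r0 rR; have t0 := tau_ge0 _ r0 (ltW rR).
rewrite subr_ge0 -[leRHS](powRK R _ q)// ?gt_eqF//.
apply: le_powR2; [exact: ltW|exact: wscale_ge0|].
apply: le_trans (wscale_le _ r0 rR) _; rewrite ler_piMl ?powR_ge0//.
rewrite -(one_powR R p^-1); apply: le_powR2 => //.
  by rewrite divr_ge0 ?energy_in_ge0// ltW.
by rewrite ler_pdivrMr// mul1r energy_in_le.
Qed.

Lemma defect_cluster (K N : R) :
  (forall s t1 D a b w1 w2 : R, 0 < s -> K * s <= t1 -> 0 <= D ->
    0 <= a -> 0 <= b -> a + b <= 1 -> 0 <= w1 -> 0 <= w2 ->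
    w1 <= a `^ p^-1 * t1 `^ q^-1 -> w2 <= w1 + b `^ p^-1 * D `^ q^-1 ->
    t1 - w1 `^ q <= s -> t1 + D - w2 `^ q <= s -> D <= K * s) ->
  0 < K -> 0 < N -> exists x0, forall r, 0 < r -> r < Rad -> defect r <= N ->
    tau r < K * N \/ x0 - K * N <= tau r <= x0 + K * N.
Proof.
move=> HK K0 N0; have KN0 : 0 < K * N by exact: mulr_gt0.
have pair r s : 0 < r -> r < s -> s < Rad -> defect r <= N -> defect s <= N ->
    K * N <= tau s -> tau r - tau s <= K * N.
  move=> r0 rs sR dr ds KN; have s0 := lt_trans r0 rs; have rR := lt_trans rs sR.
  have ers : 0 <= energy_in r s by apply: energy_in_ge0 => //; exact: ltW.
  have esR : 0 <= energy_in s Rad by exact: energy_in_ge0.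
  (* The point [s], nearer to [Rad], has the smaller tau and uses the energy of (s, Rad); [r] adds
     that of (r, s). *)
  apply: (HK N (tau s) (tau r - tau s) (energy_in s Rad / k) (energy_in r s / k)
    (wscale s) (wscale r)) => //.
  - by rewrite subr_ge0 tau_le// ltW.
  - by rewrite divr_ge0// ltW.
  - by rewrite divr_ge0// ltW.
  - by rewrite -mulrDl ler_pdivrMr// mul1r addrC -energy_inD// energy_in_le.
  - exact: wscale_ge0.
  - exact: wscale_ge0.
  - exact: wscale_le.
  - exact: wscale_leD.
  - by rewrite addrCA subrr addr0.
(* Any such point can be the centre of the window, since [pair] applies on both sides of it. If
   there is none, the first alternative always holds and [x0] is arbitrary. *)
have [[r1 [r10 r1R dr1 KN]]|no] := pselect (exists r1,
    [/\ 0 < r1, r1 < Rad, defect r1 <= N & K * N <= tau r1]).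
  exists (tau r1) => r r0 rR dr.
  have [|KNr] := ltP (tau r) (K * N); [by left|right].
  move: KN0; case: (ltgtP r r1) => [rr|rr|->] KN0.
  - have := pair _ _ r0 rr r1R dr dr1 KN; have := tau_le _ _ r0 (ltW rr).
    by move=> ? ?; apply/andP; split; lra.
  - have := pair _ _ r10 rr rR dr1 dr KNr; have := tau_le _ _ r10 (ltW rr).
    by move=> ? ?; apply/andP; split; lra.
  - by apply/andP; split; lra.
exists 0 => r r0 rR dr; left; rewrite ltNge; apply/negP => KN.
by apply: no; exists r.
Qed.

End Cluster.

Definition kweight x : R := rho R p b x * (oa * x `^ (p - 1)).

Lemma kweight_gt0 x : 0 < x -> 0 < kweight x.
Proof.
move=> x0; apply: mulr_gt0; first by apply: rho_gt0; exact: ltW.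
by apply: mulr_gt0 => //; exact: powR_gt0.
Qed.

Lemma measurable_kweight D : measurable_fun D kweight.
Proof.
apply: measurable_funM; first exact: measurable_rho.
by apply: measurable_funM => //; exact: measurable_funS (measurable_powR _).
Qed.

(** The dual weight is oa^(-1/(p-1)) (1 / x + b), the exponent alpha = p - 1 being the one that
    produces 1 / x. The factor between its integral and tau is (th + 1) oa^(1/(p-1)): this is where
    the constant mu comes from. *)
Lemma integral_kweight r s : 0 < r -> r <= s ->
  (\int[lam]_(x in `]r, s[) (kweight x `^ (- (p - 1)^-1))%:E =
    (m^-1 * (tau r - tau s))%:E)%E.
Proof.
move=> r0 rs.
have -> : (\int[lam]_(x in `]r, s[) (kweight x `^ (- (p - 1)^-1))%:E =
    \int[lam]_(x in `]r, s[) ((oa `^ (- (p - 1)^-1))%:E * (x^-1 + b)%:E))%E.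
  apply: eq_integral => x; rewrite inE /= in_itv /= => /andP[rx _].
  have x0 : 0 < x by exact: lt_trans rx.
  rewrite -EFinM /kweight powRM ?(ltW (rho_gt0 _ _ _ _ _ _))// ?(ltW b0) ?(ltW x0)//; last first.
    by apply: mulr_ge0; [exact: ltW|exact: powR_ge0].
  rewrite powRM ?powR_ge0 ?(ltW oa0)// rho_powR ?(ltW b0) ?(ltW x0)//.
  rewrite -(powRrM x) mulrN mulfV ?gt_eqF// powR_inv1 ?(ltW x0)//.
  by congr EFin; field; rewrite gt_eqF.
rewrite ge0_integralZl//=.
- rewrite integral_inv_add// tauB -EFinM; congr EFin.
  rewrite /mu div1r powRN; field.
  by rewrite !gt_eqF ?powR_gt0.
- apply/measurable_EFinP; apply: measurable_funD => //.
  apply: open_continuous_measurable_fun; first exact: interval_open.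
  move=> x; rewrite inE /= in_itv /= => /andP[rx _].
  by apply: cvgV => //; rewrite gt_eqF// (lt_trans r0).
- move=> x; rewrite /= in_itv /= => /andP[rx _].
  by rewrite lee_fin addr_ge0 ?(ltW b0)// invr_ge0 ltW// (lt_trans r0).
- by rewrite lee_fin powR_ge0.
Qed.

Section Bound.
Variables (v : R -> R) (k : R).
Hypothesis k0 : 0 < k.
Hypothesis Xv : Xdense p (p - 1) th Rad v.
Hypothesis energy : (\int[lam]_(x in `]0%R, Rad[)
  (`|derive1 v x| `^ p * kweight x)%:E <= k%:E)%E.

Definition energy_in r s : R :=
  fine (\int[lam]_(x in `]r, s[) (`|derive1 v x| `^ p * kweight x)%:E).

Let mE : measurable_fun `]0, Rad[ (fun x => (`|derive1 v x| `^ p * kweight x)%:E).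
Proof.
apply/measurable_EFinP; apply: measurable_funM; last exact: measurable_kweight.
have [_ [_ [_ [mv' _]]]] := Xv.
by apply: (measurableT_comp (measurable_powR p)); exact: measurableT_comp.
Qed.

Let E0 x : 0 < x < Rad -> (0 <= (`|derive1 v x| `^ p * kweight x)%:E)%E.
Proof. by move=> /andP[x0 _]; rewrite lee_fin mulr_ge0 ?powR_ge0// ltW// kweight_gt0. Qed.

Let subE r s : 0 <= r -> s <= Rad -> (`]r, s[%classic : set R) `<=` `]0, Rad[%classic.
Proof.
move=> r0 sR x /=; rewrite !in_itv /= => /andP[rx xs].
by rewrite (le_lt_trans r0)// (lt_le_trans xs).
Qed.

Let en_ge0E r s : 0 <= r -> s <= Rad ->
  (0 <= \int[lam]_(x in `]r, s[) (`|derive1 v x| `^ p * kweight x)%:E)%E.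
Proof. by move=> r0' sR; apply: integral_ge0 => x /(subE _ _ r0' sR); rewrite /= in_itv; exact: E0. Qed.

Let en_leE r s : 0 <= r -> s <= Rad ->
  (\int[lam]_(x in `]r, s[) (`|derive1 v x| `^ p * kweight x)%:E <= k%:E)%E.
Proof.
move=> r0' sR; apply: le_trans energy; apply: ge0_subset_integral => //.
- by apply: subE.
Qed.

Lemma energy_inE r s : 0 <= r -> s <= Rad ->
  (\int[lam]_(x in `]r, s[) (`|derive1 v x| `^ p * kweight x)%:E = (energy_in r s)%:E)%E.
Proof.
move=> r0' sR; rewrite fineK// ge0_fin_numE; last exact: en_ge0E.
by apply: le_lt_trans (en_leE _ _ r0' sR) _; exact: ltry.
Qed.

Lemma energy_in_ge0 r s : 0 <= r -> s <= Rad -> 0 <= energy_in r s.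
Proof. by move=> r0' sR; rewrite -lee_fin -energy_inE// en_ge0E. Qed.

Lemma energy_in_le r s : 0 <= r -> s <= Rad -> energy_in r s <= k.
Proof. by move=> r0' sR; rewrite -lee_fin -energy_inE// en_leE. Qed.

Lemma energy_inD r s t : 0 <= r -> r < s -> s < t -> t <= Rad ->
  energy_in r t = energy_in r s + energy_in s t.
Proof.
move=> r0' rs st tR; have s0 : 0 <= s by rewrite (le_trans r0')// ltW.
apply: EFin_inj; rewrite EFinD -!energy_inE ?(le_trans (ltW st))//.
apply: ge0_integral_split => //.
- by apply: measurable_funS mE => //; exact: subE.
- by move=> x rxt; apply: E0; have := subE _ _ r0' tR x; rewrite /= !in_itv; apply.
Qed.

Lemma tau_holder r s : 0 < r -> r < s -> s < Rad ->
  `|v s - v r| <= energy_in r s `^ p^-1 * (m^-1 * (tau r - tau s)) `^ q^-1.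
Proof.
move=> r0 rs sR; have [acv [_ [_ [mv' _]]]] := Xv; rewrite qN.
apply: (abs_cont_hoelder R v kweight p r s _ _ p1 rs).
- exact: acv.
- by apply: measurable_funS mv' => //; apply: subE; exact: ltW.
- exact: measurable_kweight.
- by move=> x /andP[rx _]; apply: kweight_gt0; exact: lt_trans rx.
- by apply: energy_in_ge0; exact: ltW.
- by rewrite mulr_ge0 ?invr_ge0 ?(ltW m0)// subr_ge0 tau_le// ltW.
- by rewrite energy_inE// ltW.
- by rewrite integral_kweight// ltW.
Qed.

End Bound.
End Moser.

(** * Summation over the layers of the defect *)

Section Layers.
Variable R : realType.
Variables (th Rad b : R).
Hypotheses (th10 : 0 < th + 1) (R0 : 0 < Rad) (b0 : 0 < b).
Notation lam := (@lebesgue_measure R).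
Notation ta := (@tau R th Rad b).
Implicit Types (r x y : R).

Lemma powR_gt0E x a : 0 < x -> x `^ a = expR (a * ln x).
Proof. by move=> x0; rewrite /powR gt_eqF. Qed.

Definition layer (A B : R) r : R := r `^ (-1) * \1_(`[A, B]%classic) r.

Lemma layer_ge0 A B r : 0 <= layer A B r.
Proof. by rewrite /layer mulr_ge0 ?powR_ge0// indicE ler0n. Qed.

Lemma measurable_layer D A B : measurable_fun D (layer A B).
Proof.
apply: measurable_funTS; apply: measurable_funM; first exact: measurable_powR.
by apply: measurable_indic; exact: measurable_itv.
Qed.

Lemma integral_layer A B : 0 < A -> A <= B ->
  (\int[lam]_(r in `]0%R, Rad[) (layer A B r)%:E <= (ln B - ln A)%:E)%E.
Proof.
move=> A0 AB; have E : forall r, (layer A B r)%:E =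
    ((fun r : R => (r `^ (-1))%:E) \_ `[A, B]) r.
  move=> r; rewrite /layer indicE patchE; case: ifPn => rAB; first by rewrite mulr1.
  by rewrite mulr0.
under eq_integral do rewrite E.
rewrite -integral_mkcondr.
have mf D : measurable_fun D (fun r : R => (r `^ (-1))%:E).
  by apply/measurable_EFinP; exact: measurable_funTS (measurable_powR _).
apply: (@le_trans _ _ (\int[lam]_(r in `[A, B]) (r `^ (-1))%:E)%E).
  apply: ge0_subset_integral => //.
  - by apply: measurableI; exact: measurable_itv.
  - exact: mf.
  - by move=> r _; rewrite lee_fin powR_ge0.
rewrite (integral_itv_bndoo true false)//.
have := integral_inv_add R A B 0 A0 AB; rewrite mul0r addr0 => <-.
rewrite le_eqVlt; apply/orP; left; apply/eqP; apply: eq_integral => r.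
rewrite inE /= in_itv /= => /andP[Ar _].
by rewrite addr0 powR_inv1// (le_trans (ltW A0))// ltW.
Qed.

(** Bounds standing in for the inverse of [tau]: its linear correction lies between 0 and (th + 1) b
    Rad, and is dropped in the first radius and taken in full in the second. *)
Definition radius_lo y := Rad * expR (- (y / (th + 1))).
Definition radius_hi x := Rad * expR (- (x / (th + 1)) + b * Rad).

Lemma ln_radius_lo y : ln (radius_lo y) = ln Rad - y / (th + 1).
Proof. by rewrite /radius_lo lnM ?posrE ?expR_gt0// expRK. Qed.

Lemma ln_radius_hi x : ln (radius_hi x) = ln Rad - x / (th + 1) + b * Rad.
Proof. by rewrite /radius_hi lnM ?posrE ?expR_gt0// expRK addrA. Qed.

Lemma radius_lo_gt0 y : 0 < radius_lo y. Proof. by rewrite mulr_gt0 ?expR_gt0. Qed.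
Lemma radius_hi_gt0 y : 0 < radius_hi y. Proof. by rewrite mulr_gt0 ?expR_gt0. Qed.

#[local] Opaque radius_lo radius_hi.

Lemma tau_level r x y : 0 < r -> r < Rad -> x <= ta r <= y -> radius_lo y <= r <= radius_hi x.
Proof.
move=> r0 rR; rewrite /tau => /andP[h1 h2].
have bR : 0 <= b * (Rad - r).
  by apply: mulr_ge0; [exact: ltW|rewrite subr_ge0; exact: ltW].
have br : 0 <= b * r by apply: mulr_ge0; exact: ltW.
have {}h1 : x / (th + 1) <= ln Rad - ln r + b * (Rad - r).
  by rewrite ler_pdivrMr// mulrC.
have {}h2 : ln Rad - ln r + b * (Rad - r) <= y / (th + 1).
  by rewrite ler_pdivlMr// mulrC.
have := radius_lo_gt0 y; have := radius_hi_gt0 x.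
move=> x0 y0; apply/andP; split; rewrite -ler_ln; try by rewrite posrE.
  by rewrite ln_radius_lo; lra.
by rewrite ln_radius_hi; lra.
Qed.

(** Up to a bounded factor exp(tau) is r^(-(th+1)), which explains the coefficient th + 1 in
    [tau]. *)
Lemma expR_tau r : 0 < r -> r < Rad ->
  expR (ta r) * r `^ th <= expR ((th + 1) * (ln Rad + b * Rad)) * r `^ (-1).
Proof.
move=> r0 rR; rewrite !powR_gt0E// -!expRD ler_expR /tau.
have br : 0 <= (th + 1) * (b * r) by apply: mulr_ge0; [exact: ltW|apply: mulr_ge0; exact: ltW].
have -> : (th + 1) * (ln Rad - ln r + b * (Rad - r)) + th * ln r =
  (th + 1) * (ln Rad + b * Rad) + -1 * ln r - (th + 1) * (b * r) by ring.
lra.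
Qed.

Lemma sum_expR_le (n : nat) (z : R) : 0 <= z -> z < 1 ->
  \sum_(0 <= i < n) z ^+ i <= (1 - z)^-1.
Proof.
move=> z0 z1; have z10 : 0 < 1 - z by rewrite subr_gt0.
rewrite -(ler_pM2l z10) mulfV ?gt_eqF// big_mkord.
have -> : (1 - z) * \sum_(i < n) z ^+ i = 1 - z ^+ n by rewrite -opprB mulNr -subrX1 opprB.
by rewrite gerBl exprn_ge0.
Qed.

(* [exp (y r)] is at most [exp (tau r - n)] on the n-th layer [n <= tau - y < n+1];
   a layer sits in two windows of [tau] of length O(n+1), on which
   [exp (tau r) r^th dr] is comparable to [dr / r], i.e. to [d tau]. *)
Lemma wint_expR_le (K : R) : 0 < K -> exists C : R, forall y : R -> R,
  measurable_fun `]0, Rad[ y ->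
  (forall r, 0 < r -> r < Rad -> 0 <= ta r - y r) ->
  (forall N, 0 < N -> exists x0, forall r, 0 < r -> r < Rad -> ta r - y r <= N ->
    ta r < K * N \/ x0 - K * N <= ta r <= x0 + K * N) ->
  (wint th Rad (fun r => expR (y r)) <= C%:E)%E.
Proof.
(* Half of the decay exp(-n) is kept as z^n; the other half absorbs the length of the windows, by n
   + 1 <= 2 exp(n/2). *)
move=> K0; pose z : R := expR (- 2^-1).
have z0 : 0 <= z by exact: expR_ge0.
have z1 : z < 1 by rewrite expR_lt1 oppr_lt0 invr_gt0.
have [c0 c0E c00] : exists2 c0 : R,
    c0 = omega th * expR ((th + 1) * (ln Rad + b * Rad)) & 0 <= c0.
  by eexists; [reflexivity|apply: mulr_ge0; [exact: omega_ge0|exact: expR_ge0]].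
(* In ln r the two windows have lengths K (n+1) / (th+1) and 2 K (n+1) / (th+1), each enlarged by b
   Rad. *)
pose c1 := 3 * K / (th + 1) + 2 * b * Rad.
have c10 : 0 <= c1.
  by rewrite addr_ge0// !mulr_ge0 ?(ltW K0) ?(ltW b0) ?(ltW R0)// invr_ge0 ltW.
exists (c0 * (c1 * 2) * (1 - z)^-1) => y my y0 cl.
have cl' n : exists x0, forall r, 0 < r -> r < Rad -> ta r - y r <= n.+1%:R ->
    ta r < K * n.+1%:R \/ x0 - K * n.+1%:R <= ta r <= x0 + K * n.+1%:R.
  by apply: cl; rewrite ltr0n.
have [X HX] := choice cl'.
pose g n r := layer (radius_lo (K * n.+1%:R)) (radius_hi 0) r +
  layer (radius_lo (X n + K * n.+1%:R)) (radius_hi (X n - K * n.+1%:R)) r.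
pose f n r := (c0 * expR (- n%:R) * g n r)%:E.
have g0 n r : 0 <= g n r by rewrite addr_ge0 ?layer_ge0.
have f0 n r : (0 <= f n r)%E by rewrite lee_fin !mulr_ge0 ?expR_ge0.
have mg n D : measurable_fun D (g n).
  by apply: measurable_funD; exact: measurable_layer.
have mf n D : measurable_fun D (f n).
  by apply/measurable_EFinP; apply: measurable_funM.
have pt r : 0 < r -> r < Rad ->
    ((expR (y r) * (omega th * r `^ th))%:E <= \sum_(n <oo) f n r)%E.
  move=> r0 rR; have d0 := y0 r r0 rR; pose n := Num.Def.trunc (ta r - y r).
  have n1 : n%:R <= ta r - y r by rewrite -truncn_ge_nat.
  have n2 : ta r - y r <= n.+1%:R by apply: ltW; rewrite -truncn_le_nat.
  apply: (@le_trans _ _ (f n r)); last first.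
    apply: le_trans (nneseries_lim_ge n.+1 _); last by move=> *; exact: f0.
    rewrite big_nat_recr//= leeDr// sume_ge0// => *; exact: f0.
  rewrite lee_fin.
  have g1 : r `^ (-1) <= g n r.
    have [h|h] := HX n r r0 rR n2.
      have t0 : 0 <= ta r.
        exact: tau_ge0 (ltW rR).
      have /andP[a1 a2] := tau_level r 0 (K * n.+1%:R) r0 rR (introT andP (conj t0 (ltW h))).
      rewrite /g -[leLHS]addr0 lerD ?layer_ge0// /layer indicE mem_set ?mulr1//.
      by rewrite /= in_itv /= a1 a2.
    have /andP[a1 a2] := tau_level r _ _ r0 rR h.
    rewrite /g -[leLHS]add0r lerD ?layer_ge0// /layer indicE mem_set ?mulr1//.
    by rewrite /= in_itv /= a1 a2.
  apply: (@le_trans _ _ (c0 * expR (- n%:R) * r `^ (-1))); last first.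
    by rewrite ler_wpM2l// mulr_ge0 ?expR_ge0.
  have -> : y r = - (ta r - y r) + ta r by ring.
  rewrite expRD -mulrA.
  have : expR (- (ta r - y r)) <= expR (- n%:R) by rewrite ler_expR lerN2.
  move=> h; apply: le_trans (ler_wpM2r _ h) _.
    by apply: mulr_ge0; [exact: expR_ge0|apply: mulr_ge0; [exact: omega_ge0|exact: powR_ge0]].
  rewrite [c0 * _]mulrC -[leRHS]mulrA ler_wpM2l ?expR_ge0//.
  rewrite mulrCA c0E -[leRHS]mulrA ler_wpM2l ?omega_ge0//.
  exact: expR_tau.
have fint n : (\int[lam]_(r in `]0%R, Rad[) f n r <= (c0 * (c1 * 2) * z ^+ n)%:E)%E.
  rewrite /f; under eq_integral do rewrite EFinM.
  rewrite ge0_integralZl//=; last 3 first.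
  - by apply/measurable_EFinP; exact: mg.
  - by move=> r _; rewrite lee_fin; exact: g0.
  - by rewrite lee_fin mulr_ge0 ?expR_ge0.
  have -> : (\int[lam]_(r in `]0%R, Rad[) (g n r)%:E =
      \int[lam]_(r in `]0%R, Rad[) (layer (radius_lo (K * n.+1%:R)) (radius_hi 0) r)%:E +
      \int[lam]_(r in `]0%R, Rad[)
        (layer (radius_lo (X n + K * n.+1%:R)) (radius_hi (X n - K * n.+1%:R)) r)%:E)%E.
    rewrite -ge0_integralD//=.
    - by move=> r _; rewrite lee_fin layer_ge0.
    - by apply/measurable_EFinP; exact: measurable_layer.
    - by move=> r _; rewrite lee_fin layer_ge0.
    - by apply/measurable_EFinP; exact: measurable_layer.
  have KN : 0 <= K * n.+1%:R by rewrite mulr_ge0 ?ler0n// ltW.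
  have lr x x' : x <= x' -> radius_lo x' <= radius_hi x.
    move=> xx; have := radius_lo_gt0 x'; have := radius_hi_gt0 x => h1 h2.
    rewrite -ler_ln; try by rewrite posrE.
    rewrite ln_radius_lo ln_radius_hi.
    have : x / (th + 1) <= x' / (th + 1) by rewrite ler_pM2r ?invr_gt0.
    have : 0 <= b * Rad by rewrite mulr_ge0// ltW.
    lra.
  have I1 := integral_layer _ _ (radius_lo_gt0 (K * n.+1%:R)) (lr _ _ KN).
  have I2 := integral_layer _ _ (radius_lo_gt0 (X n + K * n.+1%:R))
     (lr (X n - K * n.+1%:R) (X n + K * n.+1%:R) _).
  have {}I2 := I2 (le_trans (_ : _ <= X n) (_ : X n <= _)).
  have cn0 : 0 <= c0 * expR (- n%:R) by rewrite mulr_ge0 ?expR_ge0.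
  apply: le_trans (lee_wpmul2l _ (leeD I1 (I2 _ _))) _.
  - by rewrite lee_fin.
  - by rewrite gerBl.
  - by rewrite lerDl.
  rewrite -EFinD -EFinM lee_fin.
  have -> : ln (radius_hi 0) - ln (radius_lo (K * n.+1%:R)) +
     (ln (radius_hi (X n - K * n.+1%:R)) - ln (radius_lo (X n + K * n.+1%:R))) =
     3 * K / (th + 1) * n.+1%:R + 2 * b * Rad.
    rewrite (ln_radius_hi 0).
    rewrite (ln_radius_hi (X n - K * n.+1%:R)).
    rewrite (ln_radius_lo (X n + K * n.+1%:R)).
    rewrite (ln_radius_lo (K * n.+1%:R)).
    by field; rewrite gt_eqF.
  have e1 : expR (- n%:R) * n.+1%:R <= 2 * z ^+ n.
    rewrite -expRM_natl -[- n%:R]/(- n%:R).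
    have -> : - n%:R = n%:R * - 2^-1 + - (n%:R / 2) :> R by field.
    rewrite expRD -mulrA [leRHS]mulrC ler_wpM2l ?expR_ge0//.
    rewrite expRN ler_pdivrMl ?expR_gt0//.
    have := expR_ge1Dx (n%:R / 2 : R); rewrite -(natr1 n); lra.
  have n1 : 1 <= n.+1%:R :> R by rewrite ler1n.
  have h1 : 3 * K / (th + 1) * n.+1%:R + 2 * b * Rad <= c1 * n.+1%:R.
    rewrite /c1 [leRHS]mulrDl; apply: lerD => //; apply: ler_peMr => //.
    by apply: mulr_ge0; [apply: mulr_ge0|]; exact: ltW.
  apply: le_trans (ler_wpM2l cn0 h1) _.
  by rewrite -!mulrA ler_wpM2l// mulrCA ler_wpM2l.
rewrite /wint.
apply: (@le_trans _ _ (\int[lam]_(r in `]0%R, Rad[) (\sum_(n <oo) f n r))%E).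
  apply: ge0_le_integral => //=.
  - move=> r _; rewrite lee_fin; apply: mulr_ge0; first exact: expR_ge0.
    by apply: mulr_ge0; [exact: omega_ge0|exact: powR_ge0].
  - apply/measurable_EFinP; apply: measurable_funM.
      exact: (measurableT_comp (@measurable_expR R)).
    by apply: measurable_funM => //; exact: measurable_funTS (measurable_powR _).
  - have := @ge0_emeasurable_sum _ _ R `]0, Rad[%classic f xpredT.
    by apply.
  - by move=> r; rewrite in_itv /= => /andP[]; exact: pt.
rewrite integral_nneseries//; last by move=> n; exact: mf.
apply: lime_le.
  by apply: is_cvg_nneseries => n _ _; apply: integral_ge0 => r _; exact: f0.
apply: nearW => n.
apply: (@le_trans _ _ (\sum_(0 <= i < n) (c0 * (c1 * 2) * z ^+ i)%:E)%E).
  by apply: lee_sum => i _; exact: fint.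
rewrite sumEFin lee_fin -mulr_sumr ler_wpM2l ?sum_expR_le//.
by rewrite mulr_ge0// mulr_ge0.
Qed.

End Layers.

Section MoserDense.
Variable R : realType.
Variables (p th Rad b : R).
Hypotheses (p2 : 2 <= p) (R0 : 0 < Rad) (pth : p - 1 <= th) (b0 : 0 < b).
Hypothesis oa0 : 0 < @omega R (p - 1).
Notation lam := (@lebesgue_measure R).
Notation oa := (@omega R (p - 1)).
Notation m := (@mu R (p - 1) th).
Notation q := (p / (p - 1)).
Notation kweight := (@kweight R p b).
Implicit Types (v : R -> R).

Let p0 : 0 < p. Proof. by apply: lt_le_trans p2. Qed.
Let p1 : 1 < p. Proof. by apply: lt_le_trans p2; rewrite ltr1n. Qed.
Let p10 : 0 < p - 1. Proof. by rewrite subr_gt0. Qed.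
Let th10 : 0 < th + 1. Proof. by rewrite addr_gt0// (lt_le_trans p10). Qed.
Let m0 : 0 < m. Proof. by rewrite /mu mulr_gt0// powR_gt0. Qed.

Lemma cvg_at_left_small v (r e : R) : v x @[x --> Rad^'-] --> (0 : R) ->
  r < Rad -> 0 < e -> exists y, [/\ r < y, y < Rad & `|v y| < e].
Proof.
move=> cv rR e0.
have : \forall y \near Rad^'-, [/\ r < y, y < Rad & `|v y| < e].
  near=> y; split.
  - by near: y; exact: nbhs_left_gt.
  - by near: y; exact: nbhs_left_lt.
  - rewrite -[v y]subr0 distrC; near: y.
    by move/cvgrPdist_lt : cv; exact.
move=> /filter_ex[y]; by exists y.
Unshelve. all: by end_near. Qed.

(** [C] depends on neither [k] nor [v]: the approximants used later have energy bounds slightly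
    above 1, each with its own normalization. *)
Lemma moser_dense : exists C : R, forall k v, 0 < k ->
  Xdense p (p - 1) th Rad v ->
  (\int[lam]_(x in `]0%R, Rad[) (`|derive1 v x| `^ p * kweight x)%:E <= k%:E)%E ->
  (wint th Rad (fun r => expR (m * `|v r| `^ q * k `^ (- (p - 1)^-1))) <= C%:E)%E.
Proof.
have [K K1 HK] := moser_pair R p p1.
have K0 : 0 < K by exact: lt_le_trans K1.
have [C HC] := wint_expR_le R th Rad b th10 R0 b0 K K0.
exists C => k v k0 Xv env.
have H1 r s : 0 < r -> r < s -> s <= Rad -> 0 <= energy_in R p b v r s.
  by move=> r0 _ sR; apply: (energy_in_ge0 R p th Rad b b0 oa0 v k) => //; exact: ltW.
have H2 r s : 0 < r -> r < s -> s <= Rad -> energy_in R p b v r s <= k.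
  by move=> r0 _ sR; apply: (energy_in_le R p th Rad b b0 oa0 v k) => //; exact: ltW.
have H3 r s t : 0 < r -> r < s -> s < t -> t <= Rad ->
    energy_in R p b v r t = energy_in R p b v r s + energy_in R p b v s t.
  by move=> r0 rs st tR; apply: (energy_inD R p th Rad b b0 oa0 v k) => //; exact: ltW.
have H4 := tau_holder R p th Rad b p2 pth b0 oa0 v k Xv env.
have [_ [cv [[mv _] _]]] := Xv.
have H5 r e : r < Rad -> 0 < e -> exists y, [/\ r < y, y < Rad & `|v y| < e].
  exact: cvg_at_left_small.
have E r : m * `|v r| `^ q * k `^ (- (p - 1)^-1) = wscale R p m k v r `^ q.
  by rewrite wscale_powR.
under [X in wint _ _ X]funext do rewrite E.
apply: HC.
- apply: (measurableT_comp (measurable_powR q)).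
  apply: measurable_funM => //.
  exact: measurableT_comp.
- exact: (defect_ge0 R p th Rad b p2 pth b0 m k v (energy_in R p b v) m0 k0
    H1 H2 H3 H4 H5).
- move=> N N0.
  exact: (defect_cluster R p th Rad b p2 pth b0 m k v (energy_in R p b v) m0 k0
    H1 H2 H3 H4 H5 K N HK K0 N0).
Qed.

Lemma energy_le_deficit (nu k : R) v : 0 <= nu ->
  Xdense p (p - 1) th Rad v ->
  (nu%:E * Lpnp p th Rad v <= \int[lam]_(x in `]0%R, Rad[)
    (`|derive1 v x| `^ p * ((1 - rho R p b x) * (oa * x `^ (p - 1))))%:E)%E ->
  fine (Lpnp p (p - 1) Rad (derive1 v)) - nu * fine (Lpnp p th Rad v) <= k ->
  (\int[lam]_(x in `]0%R, Rad[) (`|derive1 v x| `^ p * kweight x)%:E <= k%:E)%E.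
Proof.
move=> nu0 [_ [_ [inv inv']]] co dk.
have [mv' _] := inv'.
have mpw : measurable_fun `]0, Rad[ (fun x => `|derive1 v x| `^ p).
  by apply: (measurableT_comp (measurable_powR p)); exact: measurableT_comp.
have mxp : measurable_fun `]0, Rad[ (fun x : R => oa * x `^ (p - 1)).
  by apply: measurable_funM => //; exact: measurable_funTS (measurable_powR _).
have wx0 (x : R) : 0 <= oa * x `^ (p - 1).
  by apply: mulr_ge0; [exact: ltW|exact: powR_ge0].
have f1 : forall x, `]0, Rad[%classic x -> (0 <= (`|derive1 v x| `^ p * kweight x)%:E)%E.
  move=> x; rewrite /= in_itv /= => /andP[x0 _]; rewrite lee_fin.
  by apply: mulr_ge0; [exact: powR_ge0|apply: ltW; exact: kweight_gt0].
have f2 : forall x, `]0, Rad[%classic x ->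
    (0 <= (`|derive1 v x| `^ p * ((1 - rho R p b x) * (oa * x `^ (p - 1))))%:E)%E.
  move=> x; rewrite /= in_itv /= => /andP[x0 _]; rewrite lee_fin.
  apply: mulr_ge0; first exact: powR_ge0.
  by apply: mulr_ge0; [rewrite subr_ge0 rho_le1// ltW|exact: wx0].
have L : Lpnp p (p - 1) Rad (derive1 v) =
    (\int[lam]_(x in `]0%R, Rad[) (`|derive1 v x| `^ p * kweight x)%:E +
    \int[lam]_(x in `]0%R, Rad[)
      (`|derive1 v x| `^ p * ((1 - rho R p b x) * (oa * x `^ (p - 1))))%:E)%E.
  rewrite -ge0_integralD//=.
  - by apply: eq_integral => x _; rewrite -EFinD /kweight; congr EFin; ring.
  - apply/measurable_EFinP; apply: measurable_funM => //; exact: measurable_kweight.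
  - apply/measurable_EFinP; apply: measurable_funM => //.
    apply: measurable_funM => //; apply: measurable_funB => //; exact: measurable_rho.
have := inLp_fin_num _ _ _ _ _ inv'; have := inLp_fin_num _ _ _ _ _ inv.
have := integral_ge0 lam f1; have := integral_ge0 lam f2.
move: co dk; rewrite L.
case: (Lpnp p th Rad v) => // l.
move: (\int[lam]_(x in _) (`|derive1 v x| `^ p * kweight x)%:E)%E.
move: (\int[lam]_(x in _) (_ * (_ * _))%:E)%E => [i2||] [i1||] //.
by rewrite -EFinM !lee_fin /=; lra.
Qed.

End MoserDense.

(** * Passage to the completion *)

Section Limits.
Variable R : realType.
Notation lam := (@lebesgue_measure R).

Lemma cvg_powR_gt0 (f : nat -> R) (a x : R) : 0 < a -> f n @[n --> \oo] --> a ->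
  f n `^ x @[n --> \oo] --> a `^ x.
Proof.
move=> a0 fa.
have c : {for a, continuous (fun y : R => y `^ x)}.
  apply: differentiable_continuous; apply/derivable1_diffP.
  by apply: derivable_powR; rewrite in_itv/= a0.
exact: (cvg_comp _ _ fa c).
Qed.

Lemma cvg_norm_powR (w : nat -> R) (a q : R) : 0 < q -> w n @[n --> \oo] --> a ->
  `|w n| `^ q @[n --> \oo] --> `|a| `^ q.
Proof.
move=> q0 wa; have naw : `|w n| @[n --> \oo] --> `|a| by exact: cvg_norm.
have [a0|a0] := eqVneq a 0; last by apply: cvg_powR_gt0 => //; rewrite normr_gt0.
rewrite a0 normr0 powR0 ?gt_eqF//.
apply/cvgrPdist_lt => e e0.
move: naw; rewrite a0 normr0 => /cvgrPdist_lt /(_ (e `^ q^-1) (powR_gt0 _ e0)).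
apply: filterS => n /=; rewrite !sub0r !normrN normr_id => h.
rewrite ger0_norm ?powR_ge0// -[ltRHS](powRK R e q) ?(ltW e0) ?gt_eqF//.
by rewrite gt0_ltr_powR ?nnegrE ?powR_ge0.
Qed.

Lemma ae_cvg_integral_le d (T : measurableType d) (mu : {measure set T -> \bar R})
    (D : set T) (f : nat -> T -> \bar R) (g : T -> \bar R) (C : \bar R) :
  measurable D -> (forall n, measurable_fun D (f n)) ->
  (forall n x, D x -> (0 <= f n x)%E) ->
  measurable_fun D g -> (forall x, D x -> (0 <= g x)%E) ->
  {ae mu, forall x, D x -> f n x @[n --> \oo] --> g x} ->
  (forall n, \int[mu]_(x in D) f n x <= C)%E ->
  (\int[mu]_(x in D) g x <= C)%E.
Proof.
move=> mD mf f0 mg g0 [N [mN N0 sub]] fC.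
have mDN : measurable (D `\` N) by exact: measurableD.
rewrite (ge0_negligible_integral mN mD mg g0 N0).
have -> : (\int[mu]_(x in D `\` N) g x =
    \int[mu]_(x in D `\` N) limn_einf (f ^~ x))%E.
  apply: eq_integral => x; rewrite inE => -[Dx Nx].
  have : f n x @[n --> \oo] --> g x.
    by move: Dx; apply: contrapT => h; apply: Nx; apply: sub => /= h'; apply: h.
  by move=> /cvg_limn_einf_sup[->].
apply: le_trans (fatou mu mDN _ _) _.
- by move=> n; apply: measurable_funS (mf n) => // x [].
- by move=> n x [Dx _]; exact: f0.
rewrite limn_einf_lim; apply: lime_le; first exact: is_cvg_einfs.
apply: nearW => n; apply: le_trans (ereal_inf_lbound _) _.
  by exists n; [exact: leqnn|reflexivity].
apply: le_trans (fC n); apply: ge0_subset_integral => //.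
- by move=> x; exact: f0.
Qed.

Lemma fine_cvg0 (x : nat -> \bar R) (e : R) : 0 < e -> x n @[n --> \oo] --> 0%E ->
  \forall n \near \oo, x n \is a fin_num /\ fine (x n) < e.
Proof.
move=> e0 /fine_cvgP[xf x0]; apply: filterI xf _.
exact: (cvgr_lt _ x0).
Qed.

Section AeCvg.
Variables (p th Rad : R) (u : R -> R) (w : nat -> R -> R).
Hypotheses (p0 : 0 < p) (ot0 : 0 < @omega R th).
Hypotheses (mu : measurable_fun `]0, Rad[ u) (mw : forall n, measurable_fun `]0, Rad[ (w n)).

(** The sum of the integrands has an integral bounded by a geometric series, so it is finite almost
    everywhere and its terms tend to 0; the weight being positive, |w j r - u r| tends to 0. *)
Lemma Lpnp_summable_ae_cvg :
  (forall j, Lpnp p th Rad (fun r => (w j r - u r)%R) <= (1 / (2 ^ (j + 1))%:R)%:E)%E ->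
  {ae lam, forall r, `]0, Rad[%classic r -> w j r @[j --> \oo] --> u r}.
Proof.
move=> wu.
pose f j r := (`|w j r - u r| `^ p * (omega th * r `^ th))%:E.
have f0 j r : (0 <= f j r)%E.
  rewrite lee_fin; apply: mulr_ge0; first exact: powR_ge0.
  by apply: mulr_ge0; [exact: ltW|exact: powR_ge0].
have mf j : measurable_fun `]0, Rad[ (f j).
  apply/measurable_EFinP; apply: measurable_funM.
    apply: (measurableT_comp (measurable_powR p)).
    by apply: measurableT_comp => //; exact: measurable_funB.
  by apply: measurable_funM => //; exact: measurable_funTS (measurable_powR _).
have mF : measurable_fun `]0, Rad[ (fun r => \sum_(j <oo) f j r)%E.
  have := @ge0_emeasurable_sum _ _ R `]0, Rad[%classic f xpredT.
  by apply.
have If : (\int[lam]_(r in `]0%R, Rad[) (\sum_(j <oo) f j r) < +oo)%E.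
  rewrite integral_nneseries//.
  apply: le_lt_trans (_ : (1 / 2 ^+ 0)%:E < +oo)%E; last exact: ltry.
  rewrite -(cvg_lim _ (@cvg_geometric_eseries_half R 1 0))//.
  apply: lee_nneseries => j _; last exact: wu.
  by move=> _; apply: integral_ge0 => r _; exact: f0.
have F0 r : (0 <= \sum_(j <oo) f j r)%E by apply: nneseries_ge0 => *; exact: f0.
have iF : lam.-integrable `]0, Rad[ (fun r => \sum_(j <oo) f j r)%E.
  apply/integrableP; split => //.
  by under eq_integral do rewrite gee0_abs//.
have ae := @integrable_ae _ _ _ lam _ (measurable_itv `]0, Rad[) _ iF.
move: ae => [N [mN N0 sub]]; exists N; split => // r nr; apply: sub => /= h; apply: nr => rR.
have {h} := h rR; rewrite ge0_fin_numE// => Fr.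
have r0 : 0 < r by move: rR; rewrite /= in_itv /= => /andP[].
have c0 : 0 < omega th * r `^ th by apply: mulr_gt0 => //; exact: powR_gt0.
have : f j r @[j --> \oo] --> 0%E.
  apply: (squeeze_cvge _ (cvg_cst 0%E) (nneseries_tail_cvg Fr (fun k _ => f0 k r))).
  apply: nearW => j; rewrite f0 /=.
  apply: le_trans (nneseries_lim_ge j.+1 _); last by move=> *; exact: f0.
  by rewrite big_nat1.
move=> fr; apply/cvgrPdist_lt => e e0.
have ec0 : 0 < e `^ p * (omega th * r `^ th) by apply: mulr_gt0 => //; exact: powR_gt0.
apply: filterS (fine_cvg0 _ _ ec0 fr) => j [_] /=.
rewrite ltr_pM2r// distrC => h; rewrite ltNge; apply/negP => h2.
move: h; rewrite ltNge => /negP; apply.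
by apply: le_powR2 => //; exact: ltW.
Qed.
End AeCvg.

(** Tailored to [powRD_le], whose constant depends on [kap]: [kap] is fixed before [d n] is made
    small. *)
Lemma cvg_approx (a d : nat -> R) (A : R) : 0 <= A -> (forall n, 0 <= a n) ->
  (forall n, 0 <= d n) -> (forall e, 0 < e -> \forall n \near \oo, d n < e) ->
  (forall kap, 0 < kap -> exists2 C, 0 <= C & \forall n \near \oo,
    a n <= (1 + kap) * A + C * d n /\ A <= (1 + kap) * a n + C * d n) ->
  a n @[n --> \oo] --> A.
Proof.
move=> A0 a0 d0 dcvg H; apply/cvgrPdist_le => e e0.
(* The instance kap = 1 of [H] gives a n <= 2 A + 2 eventually, so the relative error costs at most
   e / 2; the other half pays for C d n. *)
pose kap : R := e / (2 * (2 * A + 2)).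
have A2 : 0 < 2 * (2 * A + 2) by lra.
have kap0 : 0 < kap by exact: divr_gt0.
have kapE : kap * (2 * A + 2) = e / 2 by rewrite /kap; field; apply/eqP; lra.
have [C C0 HC] := H kap kap0; have [C1 C10 HC1] := H 1 ltr01.
have e1 : 0 < e / 2 / (C + 1) by rewrite !divr_gt0//; lra.
have e2 : 0 < 1 / (C1 + 1) by rewrite divr_gt0//; lra.
have D1 := dcvg _ e1; have D2 := dcvg _ e2.
apply: filterS (filterI (filterI HC HC1) (filterI D1 D2)) => n [[[i1 i2] [i3 _]] [d1 d2]].
have {}d0 := d0 n; have {}a0 := a0 n.
rewrite ltr_pdivlMr in d1; last lra.
rewrite ltr_pdivlMr in d2; last lra.
have a1 : a n <= 2 * A + 2 by lra.
have k2 := ler_wpM2l (ltW kap0) a1.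
have A3 : A <= 2 * A + 2 by lra.
have k1 := ler_wpM2l (ltW kap0) A3.
rewrite kapE in k1 k2.
by rewrite ler_norml; apply/andP; split; lra.
Qed.

Lemma fine_le_comb (x y z : \bar R) (c c' : R) : x \is a fin_num ->
  y \is a fin_num -> z \is a fin_num -> (x <= c%:E * y + c'%:E * z)%E ->
  fine x <= c * fine y + c' * fine z.
Proof. by case: x y z => [x||] [y||] [z||]. Qed.

Lemma Lpnp_distC (p s D : R) (f g : R -> R) :
  Lpnp p s D (fun r => f r - g r) = Lpnp p s D (fun r => g r - f r).
Proof. by congr wint; apply/funext => r; rewrite distrC. Qed.

#[local] Opaque Lpnp.

Lemma Lpnp_cvg (p s D : R) (f : R -> R) (g : nat -> R -> R) : 2 <= p ->
  measurable_fun `]0, D[ f -> (forall n, inLp p s D (g n)) ->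
  Lpnp p s D (fun r => g n r - f r) @[n --> \oo] --> 0%E ->
  fine (Lpnp p s D (g n)) @[n --> \oo] --> fine (Lpnp p s D f).
Proof.
move=> p2 mf ig gf; have p0 : 0 < p by apply: lt_le_trans p2.
have mg n : measurable_fun `]0, D[ (g n) by have [] := ig n.
have gfin n := inLp_fin_num _ _ _ _ _ (ig n).
(* [f] is only measurable, and [fine] would send an infinite norm to 0; finiteness comes from one
   approximant at finite distance. *)
have Afin : Lpnp p s D f \is a fin_num.
  have [C1 C10 HC1] := powRD_le R p 1 p0 ltr01.
  have /filter_ex[n [dn _]] := fine_cvg0 _ _ ltr01 gf.
  rewrite ge0_fin_numE; last exact: Lpnp_ge0.
  have := Lpnp_le_split R p p2 s D f (g n) 1 C1 ler01 C10 HC1 mf (mg n).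
  rewrite Lpnp_distC => /le_lt_trans; apply.
  by rewrite -(fineK dn) -(fineK (gfin n)); exact: ltry.
apply: (@cvg_approx _ (fun n => fine (Lpnp p s D (fun r => g n r - f r)))).
- by apply: fine_ge0; exact: Lpnp_ge0.
- by move=> n; apply: fine_ge0; exact: Lpnp_ge0.
- by move=> n; apply: fine_ge0; exact: Lpnp_ge0.
- by move=> e e0; apply: filterS (fine_cvg0 _ _ e0 gf) => n [].
- move=> kap kap0; have [C C0 HC] := powRD_le R p kap p0 kap0; exists C => //.
  apply: filterS (fine_cvg0 _ _ ltr01 gf) => n [dn _]; split.
    exact: (fine_le_comb _ _ _ _ _ (gfin n) Afin dn
      (Lpnp_le_split R p p2 s D (g n) f kap C (ltW kap0) C0 HC (mg n) mf)).
  apply: (fine_le_comb _ _ _ _ _ Afin (gfin n) dn); rewrite -Lpnp_distC.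
  exact: (Lpnp_le_split R p p2 s D f (g n) kap C (ltW kap0) C0 HC mf (mg n)).
Qed.

End Limits.

(** * The bound on the completed space *)

Section Final.
Variable R : realType.
Variables (p th Rad nu : R).
Hypotheses (p2 : 2 <= p) (R0 : 0 < Rad) (pth : p - 1 <= th) (nu0 : 0 <= nu).
Hypothesis nulam : (nu%:E < lambda_at p (p - 1) th Rad)%E.
Notation lam := (@lebesgue_measure R).
Notation m := (@mu R (p - 1) th).
Notation q := (p / (p - 1)).

Let p0 : 0 < p. Proof. by apply: lt_le_trans p2. Qed.
Let p1 : 1 < p. Proof. by apply: lt_le_trans p2; rewrite ltr1n. Qed.
Let p10 : 0 < p - 1. Proof. by rewrite subr_gt0. Qed.
Let q0 : 0 < q. Proof. exact: divr_gt0. Qed.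

Notation Q u g := (fine (Lpnp p (p - 1) Rad g) - nu * fine (Lpnp p th Rad u)).

(** By contraposition the base exceeds 1, so the value of [powR] at a negative base never enters. *)
Lemma H_nu_le1 (u g : R -> R) : H_nu p (p - 1) th Rad nu u g <= 1 -> Q u g <= 1.
Proof.
rewrite /H_nu; apply: contraTT; rewrite -!ltNge => h.
rewrite -[ltLHS](one_powR R (1 / p)); apply: (@gt0_ltr_powR _ (1 / p)); last exact: h.
- by rewrite divr_gt0.
- by rewrite nnegrE.
- by rewrite nnegrE; exact: ltW (lt_trans ltr01 h).
Qed.

(** The deficit is continuous along the approximation, so each [j] admits an index with both
    properties: a summable distance, for convergence almost everywhere, and an excess over 1 tending
    to 0. *)
Lemma Xspace_approx (u g : R -> R) : Xspace p (p - 1) th Rad u g -> Q u g <= 1 ->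
  exists w : nat -> R -> R, [/\ forall j, Xdense p (p - 1) th Rad (w j),
    forall j, (Lpnp p th Rad (fun r => (w j r - u r)%R) <= (1 / (2 ^ (j + 1))%:R)%:E)%E &
    forall j, Q (w j) (derive1 (w j)) <= 1 + harmonic j].
Proof.
move=> [mu [mg [v [Xv [vu vg]]]]] Q1.
have cu := Lpnp_cvg R p th Rad u v p2 mu (fun n => (Xv n).2.2.1) vu.
have cg := Lpnp_cvg R p (p - 1) Rad g (fun n => derive1 (v n)) p2 mg
  (fun n => (Xv n).2.2.2) vg.
have cQ : Q (v n) (derive1 (v n)) @[n --> \oo] --> Q u g.
  by apply: cvgB; [exact: cg|apply: cvgM; [exact: cvg_cst|exact: cu]].
have ex j : exists n, (Lpnp p th Rad (fun r => (v n r - u r)%R) <= (1 / (2 ^ (j + 1))%:R)%:E)%E /\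
    Q (v n) (derive1 (v n)) <= 1 + harmonic j.
  have e0 : 0 < 1 / (2 ^ (j + 1))%:R :> R by rewrite divr_gt0// ltr0n expn_gt0.
  have h1 := fine_cvg0 _ _ _ e0 vu.
  have Qj : Q u g < 1 + harmonic j.
    by apply: le_lt_trans Q1 _; rewrite ltrDl /harmonic invr_gt0 ltr0n.
  have h2 : \forall n \near \oo, Q (v n) (derive1 (v n)) < 1 + harmonic j.
    exact: (cvgr_lt _ cQ).
  have [n [[fn ln] Qn]] := filter_ex (filterI h1 h2).
  by exists n; split; [rewrite -(fineK fn) lee_fin|]; exact: ltW.
have [N HN] := choice ex.
by exists (fun j => v (N j)); split=> j; [exact: Xv|exact: (HN j).1|exact: (HN j).2].
Qed.

Lemma wint_exp_bound : 0 < @omega R (p - 1) -> 0 < @omega R th ->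
  exists C : R, forall u g, Xspace p (p - 1) th Rad u g -> Q u g <= 1 ->
  (wint th Rad (fun r => expR (m * `|u r| `^ q)) <= C%:E)%E.
Proof.
move=> oa0 ot0.
have [b b0 co] := coercive_weight R p th Rad p2 R0 pth oa0 nu nu0 nulam.
have [C HC] := moser_dense R p th Rad b p2 R0 pth b0 oa0.
exists C => u g Xu Q1; have [w [Xw wu wQ]] := Xspace_approx u g Xu Q1.
have mu : measurable_fun `]0, Rad[ u by case: Xu.
have mw j : measurable_fun `]0, Rad[ (w j) by case: (Xw j) => _ [_ [[]]].
have k0 j : 0 < 1 + harmonic j :> R.
  by apply: addr_gt0 => //; rewrite /harmonic invr_gt0 ltr0n.
have bd j := HC _ _ (k0 j) (Xw j)
  (energy_le_deficit R p th Rad b p2 b0 oa0 nu _ _ nu0 (Xw j) (co _ (Xw j)) (wQ j)).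
have ae := Lpnp_summable_ae_cvg R p th Rad u w p0 ot0 mu mw wu.
(* The normalization of the approximants tends to 1, so the limit carries exactly the constant
   mu. *)
have kcv : (1 + harmonic j : R) `^ (- (p - 1)^-1) @[j --> \oo] --> (1 : R).
  rewrite -[X in _ --> X](one_powR R (- (p - 1)^-1)); apply: cvg_powR_gt0 => //.
  by rewrite -[X in _ --> X]addr0; apply: cvgD; [exact: cvg_cst|exact: cvg_harmonic].
have mx : measurable_fun `]0, Rad[ (fun r : R => omega th * r `^ th).
  by apply: measurable_funM => //; exact: measurable_funTS (measurable_powR _).
have wx0 (r x : R) : (0 <= (expR x * (omega th * r `^ th))%:E)%E.
  rewrite lee_fin; apply: mulr_ge0; first exact: expR_ge0.
  by apply: mulr_ge0; [exact: ltW|exact: powR_ge0].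
have mp (f : R -> R) : measurable_fun `]0, Rad[ f ->
    measurable_fun `]0, Rad[ (fun r => `|f r| `^ q).
  by move=> mf; apply: (measurableT_comp (measurable_powR q)); exact: measurableT_comp.
apply: (ae_cvg_integral_le R _ _ lam _ (fun j r =>
  (expR (m * `|w j r| `^ q * (1 + harmonic j) `^ (- (p - 1)^-1)) * (omega th * r `^ th))%:E)).
- exact: measurable_itv.
- move=> j; apply/measurable_EFinP; apply: measurable_funM => //.
  apply: (measurableT_comp (@measurable_expR R)).
  apply: measurable_funM => //; apply: measurable_funM => //; exact: mp.
- by move=> j r _; exact: wx0.
- apply/measurable_EFinP; apply: measurable_funM => //.
  apply: (measurableT_comp (@measurable_expR R)).
  by apply: measurable_funM => //; exact: mp.
- by move=> r _; exact: wx0.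
- move: ae => [N [mN N0 sub]]; exists N; split => // r nr; apply: sub => /= h; apply: nr => rR.
  have {h} wr := h rR.
  apply/fine_cvgP; split; first exact: nearW.
  apply: cvgM; last exact: cvg_cst.
  apply: continuous_cvg; first exact: continuous_expR.
  rewrite -[X in _ --> X]mulr1; apply: cvgM => //.
  by apply: cvgM; [exact: cvg_cst|exact: cvg_norm_powR].
- exact: bd.
Qed.

(** [omega] is built from [fine] and a division, which return 0 by default, so its vanishing is
    treated apart instead of evaluating [Gamma]: either mu is 0 and the exponential is 1, or the
    measure is 0. *)
Lemma wint_exp_degenerate : omega (p - 1) = 0 :> R \/ omega th = 0 :> R ->
  exists C : R, forall u : R -> R,
  (wint th Rad (fun r => expR (m * `|u r| `^ q)) <= C%:E)%E.
Proof.
have th0 : 0 <= th by rewrite (le_trans _ pth)// ltW.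
move=> [oa|ot].
- exists (omega th * Rad `^ th * Rad) => u.
  have m0 : m = 0 by rewrite /mu oa powR0 ?mulr0// gt_eqF// divr_gt0.
  have -> : (fun r => expR (m * `|u r| `^ q)) = cst 1.
    by apply/funext => r; rewrite m0 mul0r expR0.
  apply: (@le_trans _ _ (\int[lam]_(r in `]0%R, Rad[) (omega th * Rad `^ th)%:E)%E).
    apply: ge0_le_integral => //.
    + move=> r _; rewrite lee_fin; apply: mulr_ge0; first exact: ler01.
      by apply: mulr_ge0; [exact: omega_ge0|exact: powR_ge0].
    + apply/measurable_EFinP; apply: measurable_funM => //.
      by apply: measurable_funM => //; exact: measurable_funTS (measurable_powR _).
    + move=> r; rewrite /= in_itv /= => /andP[r0 rR].
      rewrite mul1r lee_fin; apply: ler_wpM2l; first exact: omega_ge0.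
      by apply: le_powR2 => //; exact: ltW.
  by rewrite integral_oo_cst ?(ltW R0)// subr0.
- exists 0 => u; rewrite /wint.
  under eq_integral do rewrite ot mul0r mulr0.
  by rewrite integral0.
Qed.
End Final.

Theorem theorem1p1 (R : realType) (p Rad theta nu : R) :
  2 <= p -> 0 < Rad -> p - 1 <= theta ->
  0 <= nu -> (nu%:E < lambda_at p (p - 1) theta Rad)%E ->
  (S_sup p nu theta Rad < +oo)%E.
Proof.
move=> p2 R0 pth nu0 nulam.
have [C HC] : exists C : R, forall u g, Xspace p (p - 1) theta Rad u g ->
    H_nu p (p - 1) theta Rad nu u g <= 1 ->
    (wint theta Rad (fun r => expR (mu (p - 1) theta * `|u r| `^ (p / (p - 1)))) <= C%:E)%E.
  have := omega_ge0 R (p - 1); rewrite le_eqVlt => /orP[/eqP oa|oa].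
    have [C HC] := wint_exp_degenerate R p theta Rad p2 R0 pth (or_introl (esym oa)).
    by exists C => u g _ _; exact: HC.
  have := omega_ge0 R theta; rewrite le_eqVlt => /orP[/eqP ot|ot].
    have [C HC] := wint_exp_degenerate R p theta Rad p2 R0 pth (or_intror (esym ot)).
    by exists C => u g _ _; exact: HC.
  have [C HC] := wint_exp_bound R p theta Rad nu p2 R0 pth nu0 nulam oa ot.
  exists C => u g Xu /H_nu_le1 Q1; apply: HC Xu _.
  by apply: Q1.
apply: le_lt_trans (ltry C); apply: ge_ereal_sup => _ [u [g [Xu H1]] <-].
exact: HC Xu H1.
Qed.
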